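(* Let $L$ be the free Lie algebra over $\mathbb{C}$ on generators $a,b,c$, with $\mathfrak{sl}_3(\mathbb{C})$ acting on $L$ by derivations extending the natural representation on $L_1=\mathrm{span}\{a,b,c\}$. Then the space of Lie invariants of degree 12 (a subspace of $L_{12}$) has dimension 35.
   Context: $L=\bigoplus_{n\ge1}L_n$ is the grading of the free Lie algebra by degree (each generator has degree 1). The space $L_1$ is regarded as the natural representation of $\mathfrak{sl}_3(\mathbb{C})$ (the trace-zero $3\times3$ complex matrices acting on column vectors by matrix-vector multiplication) by identifying $a,b,c$ with the standard basis column vectors $(1,0,0)^t,(0,1,0)^t,(0,0,1)^t$ respectively. The action extends to all of $L$ by the derivation rule $D.[t,u]=[D.t,u]+[t,D.u]$ for $D\in\mathfrak{sl}_3(\mathbb{C})$. A Lie invariant of degree $j$ is an element $Z\in L_j$ with $D.Z=0$ for all $D\in\mathfrak{sl}_3(\mathbb{C})$. *)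

(* Defs.v *)
From HB Require Import structures.
From mathcomp Require Export all_boot all_algebra.
From mathcomp Require Export boolp classical_sets reals.
From mathcomp.real_closed Require Export complex.

Set Implicit Arguments.
Unset Strict Implicit.
Unset Printing Implicit Defensive.

Import GRing.Theory.
Local Open Scope quotient_scope.
Local Open Scope classical_set_scope.
Local Open Scope ring_scope.

HB.mixin Record Lmodule_isLieAlgebra (K : fieldType) V of GRing.Lmodule K V := {
  lie : V -> V -> V;
  lie_linearl : forall (k : K) (x y z : V),
    lie (k *: x + y) z = k *: lie x z + lie y z;
  lie_linearr : forall (k : K) (x y z : V),
    lie x (k *: y + z) = k *: lie x y + lie x z;
  liexx : forall x : V, lie x x = 0;
  lie_jacobi : forall x y z : V,
    lie x (lie y z) + lie y (lie z x) + lie z (lie x y) = 0 }.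

#[short(type="lieAlgType")]
HB.structure Definition LieAlgebra (K : fieldType) :=
  { V of Lmodule_isLieAlgebra K V & GRing.Lmodule K V }.

Section LieTheory.
Variables (K : fieldType) (V : lieAlgType K).
Implicit Types x y z : V.

Lemma lieDl x y z : lie (x + y) z = lie x z + lie y z.
Proof. by rewrite -[x]scale1r lie_linearl !scale1r. Qed.

Lemma lieDr x y z : lie x (y + z) = lie x y + lie x z.
Proof. by rewrite -[y]scale1r lie_linearr !scale1r. Qed.

Lemma lie0l x : lie 0 x = 0.
Proof. by apply: (addrI (lie 0 x)); rewrite -lieDl !addr0. Qed.

Lemma lie0r x : lie x 0 = 0.
Proof. by apply: (addrI (lie x 0)); rewrite -lieDr !addr0. Qed.

Lemma lieZl (k : K) x y : lie (k *: x) y = k *: lie x y.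
Proof. by rewrite -[k *: x]addr0 lie_linearl lie0l addr0. Qed.

Lemma lieZr (k : K) x y : lie x (k *: y) = k *: lie x y.
Proof. by rewrite -[k *: y]addr0 lie_linearr lie0r addr0. Qed.

Lemma lieC x y : lie x y = - lie y x.
Proof.
apply/eqP; rewrite -addr_eq0; apply/eqP.
by have := liexx (x + y); rewrite lieDl !lieDr !liexx add0r addr0.
Qed.

End LieTheory.

(* The free Lie algebra on X is the set of formal expressions in the elements
   of X, modulo the least congruence that validates the axioms of Lie
   algebras over K. *)
Inductive lexpr (K X : Type) : Type :=
  | LZero
  | LGen of X
  | LAdd of lexpr K X & lexpr K X
  | LScale of K & lexpr K X
  | LBracket of lexpr K X & lexpr K X.
Arguments LZero {K X}.
Arguments LGen {K X} _.

Inductive lexpr_eq (K : fieldType) (X : Type) :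
    lexpr K X -> lexpr K X -> Prop :=
  | lexpr_eq_refl s : lexpr_eq s s
  | lexpr_eq_sym s t : lexpr_eq s t -> lexpr_eq t s
  | lexpr_eq_trans s t u : lexpr_eq s t -> lexpr_eq t u -> lexpr_eq s u
  | lexpr_eq_congD s s' t t' : lexpr_eq s s' -> lexpr_eq t t' ->
      lexpr_eq (LAdd s t) (LAdd s' t')
  | lexpr_eq_congZ k s s' : lexpr_eq s s' -> lexpr_eq (LScale k s) (LScale k s')
  | lexpr_eq_congB s s' t t' : lexpr_eq s s' -> lexpr_eq t t' ->
      lexpr_eq (LBracket s t) (LBracket s' t')
  | lexpr_eq_addA s t u : lexpr_eq (LAdd s (LAdd t u)) (LAdd (LAdd s t) u)
  | lexpr_eq_addC s t : lexpr_eq (LAdd s t) (LAdd t s)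
  | lexpr_eq_add0 s : lexpr_eq (LAdd LZero s) s
  | lexpr_eq_addN s : lexpr_eq (LAdd (LScale (- 1) s) s) LZero
  | lexpr_eq_scaleA k l s : lexpr_eq (LScale k (LScale l s)) (LScale (k * l) s)
  | lexpr_eq_scale1 s : lexpr_eq (LScale 1 s) s
  | lexpr_eq_scaleDr k s t :
      lexpr_eq (LScale k (LAdd s t)) (LAdd (LScale k s) (LScale k t))
  | lexpr_eq_scaleDl k l s :
      lexpr_eq (LScale (k + l) s) (LAdd (LScale k s) (LScale l s))
  | lexpr_eq_linearl k s t u :
      lexpr_eq (LBracket (LAdd (LScale k s) t) u)
               (LAdd (LScale k (LBracket s u)) (LBracket t u))
  | lexpr_eq_linearr k s t u :
      lexpr_eq (LBracket s (LAdd (LScale k t) u))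
               (LAdd (LScale k (LBracket s t)) (LBracket s u))
  | lexpr_eq_xx s : lexpr_eq (LBracket s s) LZero
  | lexpr_eq_jacobi s t u :
      lexpr_eq (LAdd (LAdd (LBracket s (LBracket t u))
                           (LBracket t (LBracket u s)))
                     (LBracket u (LBracket s t))) LZero.

HB.instance Definition _ (K X : Type) := gen_eqMixin (lexpr K X).
HB.instance Definition _ (K X : Type) := gen_choiceMixin (lexpr K X).

Section FreeLie.
Variables (K : fieldType) (X : Type).
Implicit Types s t u : lexpr K X.

Definition lexpr_eqb s t : bool := `[< lexpr_eq s t >].

Lemma lexpr_eqb_refl : reflexive lexpr_eqb.
Proof. by move=> s; apply/asboolP; exact: lexpr_eq_refl. Qed.

Lemma lexpr_eqb_sym : symmetric lexpr_eqb.
Proof. by move=> s t; apply/asboolP/asboolP => h; exact: lexpr_eq_sym. Qed.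

Lemma lexpr_eqb_trans : transitive lexpr_eqb.
Proof.
move=> t s u /asboolP st /asboolP tu; apply/asboolP.
exact: (lexpr_eq_trans st tu).
Qed.

Canonical lexpr_equiv :=
  EquivRel lexpr_eqb lexpr_eqb_refl lexpr_eqb_sym lexpr_eqb_trans.

Definition freeLie : Type := {eq_quot lexpr_eqb}.

HB.instance Definition _ := Choice.on freeLie.
HB.instance Definition _ := EqQuotient.on freeLie.

Lemma freeLieP s t : (\pi_freeLie s = \pi_freeLie t) <-> lexpr_eq s t.
Proof.
by split => [/eqP|st]; [rewrite eqmodE => /asboolP|
  apply/eqP; rewrite eqmodE; apply/asboolP].
Qed.

Lemma freeLie_repr s : lexpr_eq (repr (\pi_freeLie s)) s.
Proof. by apply/freeLieP; rewrite reprK. Qed.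

Definition fl_zero : freeLie := \pi_freeLie LZero.
Definition fl_gen (x : X) : freeLie := \pi_freeLie (LGen x).
Definition fl_add (x y : freeLie) : freeLie :=
  \pi_freeLie (LAdd (repr x) (repr y)).
Definition fl_scale (k : K) (x : freeLie) : freeLie :=
  \pi_freeLie (LScale k (repr x)).
Definition fl_opp (x : freeLie) : freeLie := fl_scale (- 1) x.
Definition fl_lie (x y : freeLie) : freeLie :=
  \pi_freeLie (LBracket (repr x) (repr y)).

Lemma fl_add_pi s t :
  fl_add (\pi_freeLie s) (\pi_freeLie t) = \pi_freeLie (LAdd s t).
Proof. by apply/freeLieP; apply: lexpr_eq_congD; exact: freeLie_repr. Qed.

Lemma fl_scale_pi k s : fl_scale k (\pi_freeLie s) = \pi_freeLie (LScale k s).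
Proof. by apply/freeLieP; apply: lexpr_eq_congZ; exact: freeLie_repr. Qed.

Lemma fl_lie_pi s t :
  fl_lie (\pi_freeLie s) (\pi_freeLie t) = \pi_freeLie (LBracket s t).
Proof. by apply/freeLieP; apply: lexpr_eq_congB; exact: freeLie_repr. Qed.

Lemma fl_addA : associative fl_add.
Proof.
elim/quotW=> s; elim/quotW=> t; elim/quotW=> u.
rewrite (fl_add_pi t u) (fl_add_pi s t) !fl_add_pi.
by apply/freeLieP; exact: lexpr_eq_addA.
Qed.

Lemma fl_addC : commutative fl_add.
Proof.
elim/quotW=> s; elim/quotW=> t.
by rewrite !fl_add_pi; apply/freeLieP; exact: lexpr_eq_addC.
Qed.

Lemma fl_add0 : left_id fl_zero fl_add.
Proof.
by elim/quotW=> s; rewrite fl_add_pi; apply/freeLieP; exact: lexpr_eq_add0.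
Qed.

Lemma fl_addN : left_inverse fl_zero fl_opp fl_add.
Proof.
elim/quotW=> s; rewrite /fl_opp fl_scale_pi fl_add_pi.
by apply/freeLieP; exact: lexpr_eq_addN.
Qed.

HB.instance Definition _ :=
  GRing.isZmodule.Build freeLie fl_addA fl_addC fl_add0 fl_addN.

Lemma fl_scaleA k l x : fl_scale k (fl_scale l x) = fl_scale (k * l) x.
Proof.
elim/quotW: x => s; rewrite (fl_scale_pi l s) !fl_scale_pi.
by apply/freeLieP; exact: lexpr_eq_scaleA.
Qed.

Lemma fl_scale1 : left_id 1 fl_scale.
Proof.
by elim/quotW=> s; rewrite fl_scale_pi; apply/freeLieP; exact: lexpr_eq_scale1.
Qed.

Lemma fl_scaleDr : right_distributive fl_scale +%R.
Proof.
move=> k; elim/quotW=> s; elim/quotW=> t.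
rewrite /GRing.add /= (fl_add_pi s t) !fl_scale_pi fl_add_pi.
by apply/freeLieP; exact: lexpr_eq_scaleDr.
Qed.

Lemma fl_scaleDl x : {morph fl_scale^~ x : k l / k + l}.
Proof.
move=> k l; elim/quotW: x => s.
rewrite /= [RHS]/GRing.add /= !fl_scale_pi fl_add_pi.
by apply/freeLieP; exact: lexpr_eq_scaleDl.
Qed.

HB.instance Definition _ :=
  GRing.Zmodule_isLmodule.Build K freeLie
    fl_scaleA fl_scale1 fl_scaleDr fl_scaleDl.

Lemma pi_lzero : \pi_freeLie LZero = 0. Proof. by []. Qed.
Lemma pi_lgen x : \pi_freeLie (LGen x) = fl_gen x. Proof. by []. Qed.
Lemma pi_ladd s t : \pi_freeLie (LAdd s t) = \pi_freeLie s + \pi_freeLie t.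
Proof. by rewrite -fl_add_pi. Qed.
Lemma pi_lscale k s : \pi_freeLie (LScale k s) = k *: \pi_freeLie s.
Proof. by rewrite -fl_scale_pi. Qed.

Lemma fl_linearl (k : K) (x y z : freeLie) :
  fl_lie (k *: x + y) z = k *: fl_lie x z + fl_lie y z.
Proof.
elim/quotW: x => s; elim/quotW: y => t; elim/quotW: z => u.
rewrite -pi_lscale -pi_ladd !fl_lie_pi -pi_lscale -pi_ladd.
by apply/freeLieP; exact: lexpr_eq_linearl.
Qed.

Lemma fl_linearr (k : K) (x y z : freeLie) :
  fl_lie x (k *: y + z) = k *: fl_lie x y + fl_lie x z.
Proof.
elim/quotW: x => s; elim/quotW: y => t; elim/quotW: z => u.
rewrite -pi_lscale -pi_ladd !fl_lie_pi -pi_lscale -pi_ladd.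
by apply/freeLieP; exact: lexpr_eq_linearr.
Qed.

Lemma fl_xx (x : freeLie) : fl_lie x x = 0.
Proof.
by elim/quotW: x => s; rewrite fl_lie_pi; apply/freeLieP; exact: lexpr_eq_xx.
Qed.

Lemma fl_jacobi (x y z : freeLie) :
  fl_lie x (fl_lie y z) + fl_lie y (fl_lie z x) + fl_lie z (fl_lie x y) = 0.
Proof.
elim/quotW: x => s; elim/quotW: y => t; elim/quotW: z => u.
rewrite (fl_lie_pi t u) (fl_lie_pi u s) (fl_lie_pi s t) !fl_lie_pi -!pi_ladd.
by apply/freeLieP; exact: lexpr_eq_jacobi.
Qed.

HB.instance Definition _ :=
  Lmodule_isLieAlgebra.Build K freeLie fl_linearl fl_linearr fl_xx fl_jacobi.

Lemma pi_lbracket s t :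
  \pi_freeLie (LBracket s t) = lie (\pi_freeLie s) (\pi_freeLie t).
Proof. by rewrite -fl_lie_pi. Qed.

Lemma freeLie_ind (P : freeLie -> Prop) :
  P 0 -> (forall x, P (fl_gen x)) ->
  (forall x y, P x -> P y -> P (x + y)) ->
  (forall (k : K) x, P x -> P (k *: x)) ->
  (forall x y, P x -> P y -> P (lie x y)) ->
  forall x, P x.
Proof.
move=> P0 Pg PD PZ PB; elim/quotW; elim=> //.
- by move=> s Ps t Pt; rewrite pi_ladd; exact: PD.
- by move=> k s Ps; rewrite pi_lscale; exact: PZ.
- by move=> s Ps t Pt; rewrite pi_lbracket; exact: PB.
Qed.

Section UniversalProperty.
Variables (M : lieAlgType K) (f : X -> M).

Fixpoint lexpr_eval (s : lexpr K X) : M :=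
  match s with
  | LZero => 0
  | LGen x => f x
  | LAdd s t => lexpr_eval s + lexpr_eval t
  | LScale k s => k *: lexpr_eval s
  | LBracket s t => lie (lexpr_eval s) (lexpr_eval t)
  end.

Definition fl_lift (x : freeLie) : M := lexpr_eval (repr x).

Lemma lexpr_eval_eq s t : lexpr_eq s t -> lexpr_eval s = lexpr_eval t.
Proof.
elim=> {s t} //=.
- by move=> s t u _ -> _ ->.
- by move=> s s' t t' _ -> _ ->.
- by move=> k s s' _ ->.
- by move=> s s' t t' _ -> _ ->.
- by move=> s t u; rewrite addrA.
- by move=> s t; rewrite addrC.
- by move=> s; rewrite add0r.
- by move=> s; rewrite scaleN1r addNr.
- by move=> k l s; rewrite scalerA.
- by move=> s; rewrite scale1r.
- by move=> k s t; rewrite scalerDr.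
- by move=> k l s; rewrite scalerDl.
- by move=> k s t u; rewrite lie_linearl.
- by move=> k s t u; rewrite lie_linearr.
- by move=> s; rewrite liexx.
- by move=> s t u; rewrite lie_jacobi.
Qed.

Lemma fl_lift_pi s : fl_lift (\pi_freeLie s) = lexpr_eval s.
Proof. by apply: lexpr_eval_eq; exact: freeLie_repr. Qed.

Lemma fl_lift_gen x : fl_lift (fl_gen x) = f x.
Proof. exact: fl_lift_pi. Qed.

Lemma fl_lift_linear : linear fl_lift.
Proof.
move=> k; elim/quotW=> s; elim/quotW=> t.
by rewrite -pi_lscale -pi_ladd !fl_lift_pi.
Qed.

HB.instance Definition _ :=
  GRing.isLinear.Build K freeLie M *:%R fl_lift fl_lift_linear.

Lemma fl_lift_lie x y : fl_lift (lie x y) = lie (fl_lift x) (fl_lift y).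
Proof.
by elim/quotW: x => s; elim/quotW: y => t; rewrite -pi_lbracket !fl_lift_pi.
Qed.

Lemma fl_lift_unique (g : {linear freeLie -> M}) :
  (forall x y, g (lie x y) = lie (g x) (g y)) ->
  (forall x, g (fl_gen x) = f x) -> g =1 fl_lift.
Proof.
move=> gB gG; elim/freeLie_ind.
- by rewrite !linear0.
- by move=> x; rewrite gG fl_lift_gen.
- by move=> x y ex ey; rewrite !linearD ex ey.
- by move=> k x ex; rewrite !linearZ ex.
- by move=> x y ex ey; rewrite gB fl_lift_lie ex ey.
Qed.

End UniversalProperty.

Section Derivation.
Variable f : X -> freeLie.

Fixpoint lexpr_der (s : lexpr K X) : freeLie :=
  match s with
  | LZero => 0
  | LGen x => f x
  | LAdd s t => lexpr_der s + lexpr_der t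
  | LScale k s => k *: lexpr_der s
  | LBracket s t =>
      lie (lexpr_der s) (\pi_freeLie t) + lie (\pi_freeLie s) (lexpr_der t)
  end.

(* The unique derivation of the free Lie algebra that extends f. *)
Definition fl_der (x : freeLie) : freeLie := lexpr_der (repr x).

Lemma lexpr_der_eq s t : lexpr_eq s t -> lexpr_der s = lexpr_der t.
Proof.
elim=> {s t} //=.
- by move=> s t u _ -> _ ->.
- by move=> s s' t t' _ -> _ ->.
- by move=> k s s' _ ->.
- by move=> s s' t t' /freeLieP -> -> /freeLieP -> ->.
- by move=> s t u; rewrite addrA.
- by move=> s t; rewrite addrC.
- by move=> s; rewrite add0r.
- by move=> s; rewrite scaleN1r addNr.
- by move=> k l s; rewrite scalerA.
- by move=> s; rewrite scale1r.
- by move=> k s t; rewrite scalerDr.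
- by move=> k l s; rewrite scalerDl.
- move=> k s t u; rewrite pi_ladd pi_lscale !lie_linearl.
  by rewrite scalerDr addrACA.
- move=> k s t u; rewrite pi_ladd pi_lscale !lie_linearr.
  by rewrite scalerDr addrACA.
- by move=> s; rewrite lieC addNr.
- move=> s t u; rewrite !pi_lbracket.
  move: (\pi_freeLie s) (\pi_freeLie t) (\pi_freeLie u) => x y z.
  move: (lexpr_der s) (lexpr_der t) (lexpr_der u) => x' y' z'.
  rewrite !lieDr.
  rewrite [LHS](AC ((1*2)*(1*2)*(1*2)) ((1*6*8)*(2*4*9)*(3*5*7))) /=.
  by rewrite !lie_jacobi !addr0.
Qed.

Lemma fl_der_pi s : fl_der (\pi_freeLie s) = lexpr_der s.
Proof. by apply: lexpr_der_eq; exact: freeLie_repr. Qed.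

Lemma fl_der_gen x : fl_der (fl_gen x) = f x.
Proof. exact: fl_der_pi. Qed.

Lemma fl_der_linear : linear fl_der.
Proof.
move=> k; elim/quotW=> s; elim/quotW=> t.
by rewrite -pi_lscale -pi_ladd !fl_der_pi.
Qed.

HB.instance Definition _ :=
  GRing.isLinear.Build K freeLie freeLie *:%R fl_der fl_der_linear.

Lemma fl_der_lie x y : fl_der (lie x y) = lie (fl_der x) y + lie x (fl_der y).
Proof.
by elim/quotW: x => s; elim/quotW: y => t; rewrite -pi_lbracket !fl_der_pi.
Qed.

Lemma fl_der_unique (g : {linear freeLie -> freeLie}) :
  (forall x y, g (lie x y) = lie (g x) y + lie x (g y)) ->
  (forall x, g (fl_gen x) = f x) -> g =1 fl_der.
Proof.
move=> gB gG; elim/freeLie_ind.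
- by rewrite !linear0.
- by move=> x; rewrite gG fl_der_gen.
- by move=> x y ex ey; rewrite !linearD ex ey.
- by move=> k x ex; rewrite !linearZ ex.
- by move=> x y ex ey; rewrite gB fl_der_lie ex ey.
Qed.

End Derivation.

Inductive lie_monomial : nat -> freeLie -> Prop :=
  | lie_monomial_gen x : lie_monomial 1 (fl_gen x)
  | lie_monomial_lie m n x y : lie_monomial m x -> lie_monomial n y ->
      lie_monomial (m + n)%N (lie x y).

Definition fl_graded (n : nat) : set freeLie :=
  [set z | exists (r : nat) (c : 'I_r -> K) (m : 'I_r -> freeLie),
     (forall i, lie_monomial n (m i)) /\ z = \sum_(i < r) c i *: m i].

End FreeLie.

Section LinearAction.
Variables (K : fieldType) (n : nat).
Local Notation L := (freeLie K 'I_n).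

(* The identification of column vectors with the span of the generators. *)
Definition fl_vec (v : 'cV[K]_n) : L := \sum_(i < n) v i 0 *: fl_gen K i.

Lemma fl_vec_linear : linear fl_vec.
Proof.
move=> k u v; rewrite /fl_vec scaler_sumr -big_split /=.
by apply: eq_bigr => i _; rewrite !mxE scalerDl scalerA.
Qed.

HB.instance Definition _ :=
  GRing.isLinear.Build K 'cV[K]_n L *:%R fl_vec fl_vec_linear.

Lemma fl_vec_delta (i : 'I_n) : fl_vec (delta_mx i 0) = fl_gen K i.
Proof.
rewrite /fl_vec (bigD1 i) //= big1 => [|j ji].
  by rewrite mxE !eqxx scale1r addr0.
by rewrite mxE (negPf ji) scale0r.
Qed.

(* The action by derivations on L of the square matrices, which extends their
   action on column vectors; the i-th generator, which corresponds to the i-th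
   standard basis vector, is sent to the i-th column of D. *)
Definition fl_act (D : 'M[K]_n) : L -> L := fl_der (fun i => fl_vec (col i D)).

HB.instance Definition _ D := GRing.Linear.on (fl_act D).

Lemma fl_act_lie D (x y : L) :
  fl_act D (lie x y) = lie (fl_act D x) y + lie x (fl_act D y).
Proof. exact: fl_der_lie. Qed.

Lemma fl_act_vec D (v : 'cV[K]_n) : fl_act D (fl_vec v) = fl_vec (D *m v).
Proof.
rewrite {1}/fl_vec linear_sum /=.
under eq_bigr => i _ do rewrite linearZ /= [fl_act _ _]fl_der_gen -linearZ /=.
rewrite -linear_sum; congr fl_vec; apply/colP => i.
by rewrite summxE mxE; apply: eq_bigr => j _; rewrite !mxE mulrC.
Qed.

End LinearAction.

Definition sl (K : fieldType) (n : nat) : set 'M[K]_n := [set D | \tr D = 0].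
Arguments sl : clear implicits.

Definition lie_invariants (K : fieldType) (n j : nat) : set (freeLie K 'I_n) :=
  [set Z | fl_graded j Z /\ forall D, sl K n D -> fl_act D Z = 0].
Arguments lie_invariants : clear implicits.

(* S is a linear subspace of V of dimension d: it has a basis of d vectors. *)
Definition has_dim (K : fieldType) (V : lmodType K) (S : set V) (d : nat) :=
  exists e : 'I_d -> V,
    (forall c : 'I_d -> K, \sum_(i < d) c i *: e i = 0 -> forall i, c i = 0) /\
    S = [set v | exists c : 'I_d -> K, v = \sum_(i < d) c i *: e i].

(* Main.v *)
From HB Require Import structures.
Require Import Defs.
From mathcomp Require Import all_boot all_algebra.
From mathcomp Require Import boolp functions classical_sets reals.
From mathcomp.real_closed Require Import complex.
From mathcomp Require Import ring zify.

(** Let T_n be the space of tensors of degree n in a, b, c, that is, of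
    functions on the words of length n.  The matrix unit E_ij acts on T_n as a
    derivation, which replaces one letter j at a time by the letter i.

    Expanding brackets into commutators maps L_n to T_n, and sending a word to
    its right-normed bracket maps T_n back to L_n.  The composite L_n -> T_n ->
    L_n is multiplication by n (the Dynkin-Specht-Wever theorem,
    [nest_graded_expand]): T acts on L through ad, the expansion of z acts as
    ad z, and the bracket of a product u v of tensors is u acting on the
    bracket of v.  So, in characteristic zero, L_n is identified with the image
    in T_n of the Dynkin operator D, the composite in the other order, which
    satisfies D^2 = n D and commutes with gl_3.  The invariants of degree 12
    become the highest weight vectors of weight (4,4,4) in D(T_12).

    These are counted by squeezing.  For a subspace V of T_12 stable under gl_3
    let d(m), u(m) and h(m) be the dimensions of the weight space of weight m,
    of its vectors killed by E_ab, and of its vectors killed by E_ab and E_bc.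
    Rank-nullity for E_ab : (p,q,r) -> (p+1,q-1,r) gives
        d(p,q,r) - d(p+1,q-1,r) <= u(p,q,r).
    The kernel of E_ab is stable under two commuting raising operators,
    E_ac and [raise_bc] (E_bc corrected by E_ba E_ac, with a coefficient that
    depends on the weight); following a vector until it dies under both bounds
    u(p,q,r) by a sum of numbers h(m), over the highest weights m of gl_3 whose
    restriction to gl_2 contains (p,q):
        u(4,4,4) <= h(444) + h(543) + h(642) + h(741) + h(840),
        u(5,4,3) <= h(543) + h(642) + h(741) + h(840) + h(552) + h(651) + h(750),
        u(5,5,2) <= h(552) + h(651) + h(750).
    For V = T_12, peeling off the first letter shows that h(m) is at most the
    number of ballot sequences of content m ([dim_hwspace_le]), and with these
    values the inequalities for T_12 are equalities.  Since T_12 is the direct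
    sum of the stable subspaces D(T_12) and ker D, the inequalities for
    V = D(T_12) and V = ker D add up to those for T_12, so all of them are
    equalities.  Eliminating the other h(m) for V = D(T_12),
        h(444) = (d(444) - d(534)) - (d(543) - d(633)) + (d(552) - d(642)).
    Finally 12 d(m) is the trace of D on the weight space m of T_12, a sum of
    integers over the words of content m.  The evaluation of these sums gives
    h(444) = 570 - 771 + 236 = 35. *)

Set Implicit Arguments.
Unset Strict Implicit.
Unset Printing Implicit Defensive.

Import GRing.Theory Num.Theory.
Local Open Scope ring_scope.

(** * Noncommutative series on words *)

Section Series.
Variables (K : fieldType) (X : finType).

Definition series : Type := seq X -> K.
HB.instance Definition _ := GRing.Zmodule.copy series (seq X -> K).

Definition series_scale (c : K) (u : series) : series := fun w => c * u w.

Fact series_scaleA c d u :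
  series_scale c (series_scale d u) = series_scale (c * d) u.
Proof. by apply/funext => w; rewrite /series_scale mulrA. Qed.
Fact series_scale1 : left_id 1 series_scale.
Proof. by move=> u; apply/funext => w; rewrite /series_scale mul1r. Qed.
Fact series_scaleDr : right_distributive series_scale +%R.
Proof. by move=> c u v; apply/funext => w; apply: mulrDr. Qed.
Fact series_scaleDl u : {morph series_scale^~ u : c d / c + d}.
Proof. by move=> c d; apply/funext => w; apply: mulrDl. Qed.
HB.instance Definition _ := GRing.Zmodule_isLmodule.Build K series
  series_scaleA series_scale1 series_scaleDr series_scaleDl.

Implicit Types (u v t : series) (w : seq X) (x y i j k l : X).

Lemma seriesD u v w : (u + v) w = u w + v w. Proof. by []. Qed.
Lemma seriesN u w : (- u) w = - u w. Proof. by []. Qed.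
Lemma seriesZ (c : K) u w : (c *: u) w = c * u w. Proof. by []. Qed.
Lemma series0 w : (0 : series) w = 0. Proof. by []. Qed.
Definition seriesE := (seriesN, seriesD, seriesZ, series0).

(** The recursions on words below all read the first letter, so that their
    inductions are driven by this left quotient. *)
Definition residual x u : series := fun w => u (x :: w).

Fact residual_linear x : linear (residual x).
Proof. by move=> c u v; apply/funext. Qed.
HB.instance Definition _ x :=
  GRing.isLinear.Build K series series *:%R (residual x) (residual_linear x).

(** The concatenation product of noncommutative power series. *)
Definition conv : series -> series -> series := fix conv u v w : K :=
  if w is x :: w' then u [::] * v w + conv (residual x u) v w'
  else u [::] * v [::].

Lemma conv_linearl (c : K) u u' v :
  conv (c *: u + u') v = c *: conv u v + conv u' v.
Proof.
apply/funext => w; rewrite seriesD seriesZ.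
elim: w u u' => [|x w IH] u u' /=; rewrite !seriesE; first by ring.
by rewrite linearP IH; ring.
Qed.

Lemma conv_linearr (c : K) u v v' :
  conv u (c *: v + v') = c *: conv u v + conv u v'.
Proof.
apply/funext => w; rewrite seriesD seriesZ.
elim: w u => [|x w IH] u /=; rewrite !seriesE; first by ring.
by rewrite IH; ring.
Qed.

Lemma convDl u u' v : conv (u + u') v = conv u v + conv u' v.
Proof. by rewrite -[u]scale1r conv_linearl !scale1r. Qed.
Lemma convDr u v v' : conv u (v + v') = conv u v + conv u v'.
Proof. by rewrite -[v]scale1r conv_linearr !scale1r. Qed.
Lemma conv0l v : conv 0 v = 0.
Proof.
by have := conv_linearl (-1) 0 0 v; rewrite scaler0 addr0 scaleN1r addNr.
Qed.
Lemma conv0r v : conv v 0 = 0.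
Proof.
by have := conv_linearr (-1) v 0 0; rewrite scaler0 addr0 scaleN1r addNr.
Qed.
Lemma convZl (c : K) u v : conv (c *: u) v = c *: conv u v.
Proof. by rewrite -[c *: u]addr0 conv_linearl conv0l addr0. Qed.
Lemma convZr (c : K) u v : conv u (c *: v) = c *: conv u v.
Proof. by rewrite -[c *: v]addr0 conv_linearr conv0r addr0. Qed.
Lemma convNl u v : conv (- u) v = - conv u v.
Proof. by rewrite -scaleN1r convZl scaleN1r. Qed.
Lemma convNr u v : conv u (- v) = - conv u v.
Proof. by rewrite -scaleN1r convZr scaleN1r. Qed.

Lemma residual_conv x u v :
  residual x (conv u v) = u [::] *: residual x v + conv (residual x u) v.
Proof. by apply/funext. Qed.

Lemma convA u v t : conv (conv u v) t = conv u (conv v t).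
Proof.
apply/funext => w; elim: w u => [|x w IH] u /=; first by rewrite mulrA.
rewrite residual_conv conv_linearl !seriesE IH; ring.
Qed.

Definition series_lie u v : series := conv u v - conv v u.

Fact series_lie_linearl (c : K) u v t :
  series_lie (c *: u + v) t = c *: series_lie u t + series_lie v t.
Proof.
rewrite /series_lie conv_linearl conv_linearr.
by apply/funext => w; rewrite !seriesE; ring.
Qed.

Fact series_lie_linearr (c : K) u v t :
  series_lie u (c *: v + t) = c *: series_lie u v + series_lie u t.
Proof.
rewrite /series_lie conv_linearl conv_linearr.
by apply/funext => w; rewrite !seriesE; ring.
Qed.

Fact series_lie_xx u : series_lie u u = 0.
Proof. by rewrite /series_lie subrr. Qed.

Fact series_lie_jacobi u v t :
  series_lie u (series_lie v t) + series_lie v (series_lie t u)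
    + series_lie t (series_lie u v) = 0.
Proof.
rewrite /series_lie !(convDl, convDr, convNl, convNr, convA).
by apply/funext => w; rewrite !seriesE; ring.
Qed.

HB.instance Definition _ := Lmodule_isLieAlgebra.Build K series
  series_lie_linearl series_lie_linearr series_lie_xx series_lie_jacobi.

Lemma series_lieE u v : lie u v = conv u v - conv v u.
Proof. by []. Qed.

(** The derivation of the concatenation product that sends the letter j to the
    letter i and the other letters to 0: the action of the matrix unit E_ij. *)
Definition act i j : series -> series := fix act u w : K :=
  if w is x :: w' then (if x == i then u (j :: w') else 0) + act (residual x u) w'
  else 0.

Fact act_linear i j : linear (act i j).
Proof.
move=> c u v; apply/funext => w; rewrite seriesD seriesZ.
elim: w u v => [|x w IH] u v /=; first by ring.
by rewrite linearP IH; case: eqP => _; rewrite ?seriesE; ring.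
Qed.
HB.instance Definition _ i j :=
  GRing.isLinear.Build K series series *:%R (act i j) (act_linear i j).

Lemma residual_act i j x u :
  residual x (act i j u) =
    (if x == i then residual j u else 0) + act i j (residual x u).
Proof. by apply/funext => w; rewrite /residual /=; case: eqP. Qed.

Lemma act_conv i j u v :
  act i j (conv u v) = conv (act i j u) v + conv u (act i j v).
Proof.
apply/funext => w; rewrite seriesD.
elim: w u => [|x w IH] u /=; first by rewrite mul0r mulr0 addr0.
rewrite residual_conv residual_act [act i j (_ + _)]linearD linearZ.
rewrite /= !seriesE IH convDl !seriesE.
by case: eqP => _; rewrite ?conv0l ?seriesE /residual; ring.
Qed.

(** The relations of gl: substitutions at two different positions of a word
    commute, so the commutator only sees both of them at the same position. *)
Lemma act_comm i j k l u :
  act i j (act k l u) - act k l (act i j u) =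
    (if j == k then act i l u else 0) - (if i == l then act k j u else 0).
Proof.
apply/funext => w; rewrite !seriesE.
have fE (b : bool) (t : series) w' :
    (if b then t else 0) w' = if b then t w' else 0.
  by case: b.
rewrite !fE.
elim: w u => [|x w IH] u /=; first by rewrite !if_same subrr.
rewrite !residual_act !linearD !seriesE.
rewrite [LHS](_ : _ =
  (act i j (act k l (residual x u)) w - act k l (act i j (residual x u)) w) +
  ((if x == i then
      (if j == k then u (l :: w) else 0) + act k l (residual j u) w else 0)
   - (if x == k then
        (if l == i then u (j :: w) else 0) + act i j (residual l u) w else 0)
   + (if x == k then act i j (residual l u) w else 0) -
     (if x == i then act k l (residual j u) w else 0))); last first.
  by case: (x == i); case: (x == k); rewrite ?linear0 ?seriesE /=; ring.
rewrite IH [i == l]eq_sym.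
case: (eqVneq j k) => [->|_]; case: (eqVneq l i) => [->|_];
case: (x == i); case: (x == k); ring.
Qed.

Lemma act_diag i u w : act i i u w = (count_mem i w)%:R * u w.
Proof.
elim: w u => [|x w IH] u /=; first by rewrite mul0r.
rewrite IH natrD /residual; case: eqP => [->|_] /=; ring.
Qed.

Definition letter x : series := fun w => (w == [:: x])%:R.

Lemma act_empty i j u : (forall x, residual x u = 0) -> act i j u = 0.
Proof.
move=> u0; apply/funext => -[|x w] //=.
rewrite u0 linear0 seriesE addr0; case: eqP => // _.
by have := congr1 (fun t : series => t w) (u0 j).
Qed.

Lemma act_letter i j x : act i j (letter x) = (if j == x then letter i else 0).
Proof.
apply/funext => -[|y w] /=; first by case: eqP.
rewrite act_empty => [|z].
  rewrite seriesE addr0 {1}/letter eqseq_cons.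
  case: (j == x) => /=; last by rewrite if_same.
  by rewrite /letter eqseq_cons; case: (y == i).
by apply/funext => w'; rewrite /residual /letter eqseq_cons andbF.
Qed.

End Series.

(** * Expansion of Lie elements and right-normed brackets *)

Section LieSums.
Variables (K : fieldType) (V : lieAlgType K).

Fact lie_is_linear (x : V) : linear (lie x).
Proof. by move=> c y z; rewrite lie_linearr. Qed.
HB.instance Definition _ (x : V) :=
  GRing.isLinear.Build K V V *:%R (lie x) (lie_is_linear x).

Lemma lie_lieE (x y z : V) : lie (lie x y) z = lie x (lie y z) - lie y (lie x z).
Proof.
have := lie_jacobi x y z; rewrite [lie z (lie x y)]lieC [lie z x]lieC linearN.
by move/eqP; rewrite subr_eq0 => /eqP <-.
Qed.

End LieSums.

Section Homogeneous.
Variables (K : fieldType) (X : finType).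
Implicit Types (u v t : series K X) (x y : X).

Definition homog n u := forall w, size w != n -> u w = 0.

Lemma homog_residual n u x : homog n.+1 u -> homog n (residual x u).
Proof. by move=> hu w sw; apply: hu. Qed.

Lemma homogD n u v : homog n u -> homog n v -> homog n (u + v).
Proof. by move=> hu hv w sw; rewrite !seriesE hu ?hv ?addr0. Qed.

Lemma homogZ n (c : K) u : homog n u -> homog n (c *: u).
Proof. by move=> hu w sw; rewrite !seriesE hu ?mulr0. Qed.

Lemma conv_homog0 u v : homog 0 u -> conv u v = u [::] *: v.
Proof.
move=> hu; apply/funext => -[|x w] //=.
have -> : residual x u = 0 by apply/funext => w'; apply: hu.
by rewrite conv0l seriesE addr0.
Qed.

Lemma residual_conv_homog n u v x : homog n.+1 u ->
  residual x (conv u v) = conv (residual x u) v.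
Proof. by move=> hu; rewrite residual_conv hu // scale0r add0r. Qed.

Lemma homog_conv m n u v : homog m u -> homog n v -> homog (m + n) (conv u v).
Proof.
elim: m u => [|m IH] u hu hv; first by rewrite conv_homog0 //; apply: homogZ.
move=> [|x w] sw /=; first by rewrite hu ?mul0r.
have := IH _ (@homog_residual _ _ x hu) hv w sw.
by rewrite hu // mul0r add0r.
Qed.

Lemma homog_act n i j u : homog n u -> homog n (act i j u).
Proof.
move=> hu w; elim: w n u hu => [|x w IH] [|n] u hu //= sw.
  rewrite !hu ?if_same ?add0r //.
  have -> : residual x u = 0 by apply/funext => w'; apply: hu.
  by rewrite linear0.
by rewrite hu ?if_same ?add0r ?(IH n) //; apply: homog_residual.
Qed.

End Homogeneous.

Section Expansion.
Variables (K : fieldType) (X : finType).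
Local Notation L := (freeLie K X).
Implicit Types (u v t : series K X) (x : X) (z : L).

(** The canonical map from the free Lie algebra to the free associative
    algebra, with bracket the commutator. *)
Definition expand : L -> series K X := fl_lift (@letter K X).
HB.instance Definition _ := GRing.Linear.on expand.

Lemma expand_gen x : expand (fl_gen K x) = letter K x.
Proof. exact: fl_lift_gen. Qed.

Lemma expand_lie z z' : expand (lie z z') = lie (expand z) (expand z').
Proof. exact: fl_lift_lie. Qed.

Lemma lie_monomial_gt0 n z : lie_monomial n z -> (0 < n)%N.
Proof. by elim=> // m p _ _ _ m0 _ _; rewrite addn_gt0 m0. Qed.

Lemma homog_monomial n z : lie_monomial n z -> homog n (expand z).
Proof.
elim=> {n z} [x|m n y z _ hy _ hz].
  by rewrite expand_gen => -[|y [|y' w]] //= _; rewrite /letter ?eqseq_cons ?andbF.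
rewrite expand_lie series_lieE -scaleN1r; apply: homogD; first exact: homog_conv.
by apply: homogZ; rewrite addnC; apply: homog_conv.
Qed.

Lemma homog_graded n z : fl_graded n z -> homog n (expand z).
Proof.
move=> [r [c [m [mm ->]]]]; rewrite linear_sum.
elim/big_rec: _ => [|i u _ hu]; first by move=> w _; rewrite seriesE.
apply: homogD => //; rewrite linearZ; apply: homogZ; exact: homog_monomial.
Qed.

(** The action on [z] of the degree [n] part of [t], where each letter acts by
    its adjoint action and a product of letters by the composite. *)
Fixpoint adseries n z t : L :=
  if n is n'.+1 then \sum_x lie (fl_gen K x) (adseries n' z (residual x t))
  else t [::] *: z.

(** The sum over the words of length [n.+1], weighted by [t], of their
    right-normed brackets [x_0, [x_1, ... [x_(n-1), x_n]...]].  The shift by one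
    reflects that the empty word has no bracket. *)
Fixpoint nest n t : L :=
  if n is n'.+1 then \sum_x lie (fl_gen K x) (nest n' (residual x t))
  else \sum_x t [:: x] *: fl_gen K x.

Fact nest_linear n : linear (nest n).
Proof.
elim: n => [|n IH] c u v /=; rewrite scaler_sumr -big_split;
  apply: eq_bigr => x _ /=.
  by rewrite !seriesE scalerDl scalerA.
by rewrite linearP IH linearP.
Qed.
HB.instance Definition _ n :=
  GRing.isLinear.Build K (series K X) L *:%R (nest n) (nest_linear n).

Fact adseries_linear n z : linear (adseries n z).
Proof.
elim: n => [|n IH] c u v /=.
  by rewrite !seriesE scalerDl scalerA.
rewrite scaler_sumr -big_split; apply: eq_bigr => x _ /=.
by rewrite linearP IH linearP.
Qed.
HB.instance Definition _ n z :=
  GRing.isLinear.Build K (series K X) L *:%R (adseries n z) (adseries_linear n z).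

Lemma adseries_conv m n u v z : homog m u ->
  adseries (m + n) z (conv u v) = adseries m (adseries n z v) u.
Proof.
elim: m u => [|m IH] u hu.
  by rewrite conv_homog0 // linearZ.
rewrite addSn /=; apply: eq_bigr => x _.
by rewrite (residual_conv_homog v x hu) IH //; apply: homog_residual.
Qed.

Lemma nest_conv m n u v : homog m u ->
  nest (m + n) (conv u v) = adseries m (nest n v) u.
Proof.
elim: m u => [|m IH] u hu; first by rewrite conv_homog0 // linearZ.
rewrite addSn /=; apply: eq_bigr => x _.
by rewrite (residual_conv_homog v x hu) IH //; apply: homog_residual.
Qed.

(** [adseries] turns products into composites ([adseries_conv]), so both sides
    are Lie algebra morphisms in [z], to the endomorphisms of L, that agree on
    the generators. *)
Lemma adseries_expand n z y : lie_monomial n z -> adseries n y (expand z) = lie z y.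
Proof.
move=> mz; elim: mz y => {n z} [x|m n a b ma IHa mb IHb] y.
  rewrite expand_gen /= (bigD1 x) //= big1 => [|x' x'x].
    by rewrite /residual /letter eqxx scale1r addr0.
  by rewrite /residual /letter eqseq_cons (negPf x'x) scale0r linear0.
rewrite expand_lie series_lieE linearB /=.
rewrite adseries_conv; last exact: homog_monomial.
rewrite addnC adseries_conv; last exact: homog_monomial.
by rewrite !IHa !IHb lie_lieE.
Qed.

(** For z = [a, b] the expansion is a b - b a, and [nest_conv] turns the bracket
    of a b into ad a applied to the bracket of b, which is deg(b) b by
    induction.  The two terms give (deg b + deg a) [a, b]. *)
Lemma nest_monomial n z : lie_monomial n z -> nest n.-1 (expand z) = n%:R *: z.
Proof.
elim=> {n z} [x|m n a b ma IHa mb IHb].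
  rewrite expand_gen /= (bigD1 x) //= big1 => [|x' x'x].
    by rewrite /letter eqxx addr0.
  by rewrite /letter eqseq_cons (negPf x'x) scale0r.
have m0 := lie_monomial_gt0 ma; have n0 := lie_monomial_gt0 mb.
have em : ((m + n).-1 = m + n.-1)%N by lia.
have en : ((m + n).-1 = n + m.-1)%N by lia.
rewrite expand_lie series_lieE linearB /= {1}em en.
rewrite !nest_conv; [|exact: homog_monomial|exact: homog_monomial].
rewrite IHa IHb !adseries_expand // !lieZr [lie b a]lieC.
by rewrite scalerN opprK -scalerDl -natrD addnC.
Qed.

Lemma nest_graded_expand n z : fl_graded n z -> nest n.-1 (expand z) = n%:R *: z.
Proof.
move=> [r [c [m [mm ->]]]]; rewrite !linear_sum; apply: eq_bigr => i _.
by rewrite !linearZ /= nest_monomial // !scalerA mulrC.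
Qed.

Lemma graded0 n : fl_graded n (0 : L).
Proof. by exists 0%N, (fun=> 0), (fun=> 0); split=> [[]//|]; rewrite big_ord0. Qed.

Lemma gradedD n (y z : L) : fl_graded n y -> fl_graded n z -> fl_graded n (y + z).
Proof.
move=> [r [c [m [mm ->]]]] [r' [c' [m' [mm' ->]]]].
exists (r + r')%N,
  (fun i => match fintype.split i with inl a => c a | inr b => c' b end),
  (fun i => match fintype.split i with inl a => m a | inr b => m' b end); split.
  by move=> i; case: fintype.split.
rewrite big_split_ord /=; congr (_ + _); apply: eq_bigr => i _.
  by rewrite (unsplitK (inl i)).
by rewrite (unsplitK (inr i)).
Qed.

Lemma gradedZ n (c : K) z : fl_graded n z -> fl_graded n (c *: z).
Proof.
move=> [r [d [m [mm ->]]]]; exists r, (fun i => c * d i), m; split=> //.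
by rewrite scaler_sumr; apply: eq_bigr => i _; rewrite scalerA.
Qed.

Lemma graded_sum n (I : Type) (r : seq I) (P : pred I) (F : I -> L) :
  (forall i, fl_graded n (F i)) -> fl_graded n (\sum_(i <- r | P i) F i).
Proof.
move=> gF; elim/big_rec: _ => [|i z _ gz]; first exact: graded0.
exact: gradedD.
Qed.

Lemma graded_monomial n z : lie_monomial n z -> fl_graded n z.
Proof.
by move=> mz; exists 1%N, (fun=> 1), (fun=> z); split; rewrite // big_ord1 scale1r.
Qed.

Lemma graded_lie m n (y z : L) :
  fl_graded m y -> fl_graded n z -> fl_graded (m + n) (lie y z).
Proof.
move=> [r [c [f [mf ->]]]] [r' [c' [f' [mf' ->]]]].
rewrite linear_sum; apply: graded_sum => j; rewrite linearZ; apply: gradedZ => /=.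
rewrite lieC -scaleN1r; apply: gradedZ; rewrite linear_sum; apply: graded_sum => i.
rewrite linearZ; apply: gradedZ => /=; rewrite lieC -scaleN1r; apply: gradedZ.
by apply/graded_monomial/lie_monomial_lie.
Qed.

Lemma graded_nest n t : fl_graded n.+1 (nest n t).
Proof.
elim: n t => [|n IH] t /=; apply: graded_sum => x.
  by apply/gradedZ/graded_monomial/lie_monomial_gen.
by rewrite -add1n; apply: graded_lie => //; apply/graded_monomial/lie_monomial_gen.
Qed.

End Expansion.

Section Action.
Variables (K : fieldType) (n : nat).
Local Notation L := (freeLie K 'I_n).
Implicit Types (D : 'M[K]_n) (z : L) (t : series K 'I_n).

Lemma fl_act_gen D i : fl_act D (fl_gen K i) = fl_vec (col i D).
Proof. exact: fl_der_gen. Qed.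

Lemma expand_act D z :
  expand (fl_act D z) = \sum_i \sum_j D i j *: act i j (expand z).
Proof.
elim/freeLie_ind: z => [|x|y z IHy IHz|c z IHz|y z IHy IHz].
- rewrite !linear0; under eq_bigr => i _ do under eq_bigr => j _ do
    rewrite linear0 scaler0.
  by rewrite big1 // => i _; rewrite big1.
- rewrite fl_act_gen linear_sum expand_gen; apply: eq_bigr => i _ /=.
  rewrite (bigD1 x) //= big1 => [|j jx].
    by rewrite act_letter eqxx mxE linearZ /= expand_gen addr0.
  by rewrite act_letter (negPf jx) scaler0.
- rewrite !linearD /= IHy IHz -big_split; apply: eq_bigr => i _ /=.
  rewrite -big_split; apply: eq_bigr => j _ /=.
  by rewrite linearD scalerDr.
- rewrite !linearZ /= IHz scaler_sumr; apply: eq_bigr => i _ /=.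
  rewrite scaler_sumr; apply: eq_bigr => j _ /=.
  by rewrite !linearZ /= !scalerA mulrC.
rewrite fl_act_lie linearD /= !expand_lie IHy IHz.
have lieS (I : Type) (r : seq I) (P : pred I) (F : I -> series K 'I_n) u :
    lie (\sum_(i <- r | P i) F i) u = \sum_(i <- r | P i) lie (F i) u.
  by elim/big_rec2: _ => [|i a b _ <-]; rewrite ?lie0l ?lieDl.
rewrite lieS linear_sum -big_split; apply: eq_bigr => i _ /=.
rewrite lieS linear_sum -big_split; apply: eq_bigr => j _ /=.
rewrite lieZl lieZr -scalerDr !series_lieE linearB /= !act_conv.
by congr (_ *: _); apply/funext => w; rewrite !seriesE; ring.
Qed.

Lemma fl_act_delta_gen (i j x : 'I_n) :
  fl_act (delta_mx i j) (fl_gen K x) = if x == j then fl_gen K i else 0.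
Proof.
rewrite fl_act_gen; case: eqP => [->|/eqP/negPf xj].
  rewrite -fl_vec_delta; congr fl_vec; apply/colP => k.
  by rewrite !mxE !eqxx !andbT.
rewrite -[RHS](linear0 (@fl_vec K n)); congr fl_vec; apply/colP => k.
by rewrite !mxE xj andbF.
Qed.

Lemma nest_act (i j : 'I_n) m t :
  nest m (act i j t) = fl_act (delta_mx i j) (nest m t).
Proof.
elim: m t => [|m IH] t /=; rewrite linear_sum /=.
  rewrite (bigD1 i) //= big1 => [|x /negPf xi]; last by rewrite xi addr0 scale0r.
  rewrite [RHS](bigD1 j) //= big1 => [|x /negPf xj]; last first.
    by rewrite linearZ /= fl_act_delta_gen xj scaler0.
  by rewrite linearZ /= fl_act_delta_gen !eqxx !addr0.
under [RHS]eq_bigr => x _ do rewrite fl_act_lie fl_act_delta_gen -IH.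
under eq_bigr => x _ do rewrite residual_act linearD linearD /=.
rewrite !big_split; congr (_ + _) => /=.
rewrite (bigD1 i) //= big1 => [|x /negPf xi]; last by rewrite xi !linear0.
rewrite [RHS](bigD1 j) //= big1 => [|x /negPf xj]; last by rewrite xj lie0l.
by rewrite !eqxx.
Qed.

End Action.

(** * Tensors of a fixed degree and the action of the matrix units *)

Section Tensors.
Variables (K : numFieldType) (X : finType).
Implicit Types (u v : series K X) (i j k l x : X) (n : nat).

(** The finite-dimensional counterpart of the series supported in degree [n];
    the operators on it are transported from series, where induction on words
    is available without changing the type. *)
Definition tensor n : Type := {ffun n.-tuple X -> K^o}.
HB.instance Definition _ n := Vector.copy (tensor n) {ffun n.-tuple X -> K^o}.

Definition to_series n (t : tensor n) : series K X :=
  fun w => if insub w is Some v then t v else 0.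
Definition of_series n u : tensor n := [ffun w => u (tval w)].

Lemma to_seriesE n (t : tensor n) (w : n.-tuple X) : to_series t w = t w.
Proof. by rewrite /to_series valK. Qed.

Lemma of_seriesE n u (w : n.-tuple X) : of_series n u w = u w.
Proof. by rewrite ffunE. Qed.

Lemma homog_to_series n (t : tensor n) : homog n (to_series t).
Proof. by move=> w sw; rewrite /to_series insubN. Qed.

Fact to_series_linear n : linear (@to_series n).
Proof.
move=> c s t; apply/funext => w; rewrite !seriesE /to_series.
by case: insubP => [v _ _|_]; rewrite ?mulr0 ?addr0 // !ffunE.
Qed.
HB.instance Definition _ n :=
  GRing.isLinear.Build K (tensor n) (series K X) *:%R
    (@to_series n) (@to_series_linear n).

Fact of_series_linear n : linear (of_series n).
Proof. by move=> c u v; apply/ffunP => w; rewrite !ffunE. Qed.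
HB.instance Definition _ n :=
  GRing.isLinear.Build K (series K X) (tensor n) *:%R
    (of_series n) (@of_series_linear n).

Lemma to_seriesK n : cancel (@to_series n) (of_series n).
Proof. by move=> t; apply/ffunP => w; rewrite of_seriesE to_seriesE. Qed.

Lemma of_seriesK n u : homog n u -> to_series (of_series n u) = u.
Proof.
move=> hu; apply/funext => w; rewrite /to_series.
case: insubP => [v _ <-|sw]; first by rewrite of_seriesE.
by rewrite hu.
Qed.

Definition tact n i j (t : tensor n) : tensor n :=
  of_series n (act i j (to_series t)).
Fact tact_linear n i j : linear (@tact n i j).
Proof. by move=> c s t; rewrite /tact !linearP. Qed.
HB.instance Definition _ n i j :=
  GRing.isLinear.Build K (tensor n) (tensor n) *:%R
    (@tact n i j) (@tact_linear n i j).

Lemma to_series_tact n i j (t : tensor n) :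
  to_series (tact i j t) = act i j (to_series t).
Proof.
by rewrite of_seriesK //; apply: homog_act; apply: homog_to_series.
Qed.

Lemma tact_comm n i j k l (t : tensor n) :
  tact i j (tact k l t) = tact k l (tact i j t) +
    ((if j == k then tact i l t else 0) - (if i == l then tact k j t else 0)).
Proof.
apply/eqP; rewrite addrC -subr_eq; apply/eqP.
apply: (can_inj (@to_seriesK n)); rewrite !linearB /= !to_series_tact act_comm.
by congr (_ - _); case: eqP => _; rewrite ?linear0 // to_series_tact.
Qed.

Lemma tact_diag n i (t : tensor n) (w : n.-tuple X) :
  tact i i t w = (count_mem i w)%:R * t w.
Proof. by rewrite -to_seriesE to_series_tact act_diag to_seriesE. Qed.

(** The eigenvalues of E_ii are numbers of occurrences of the letter i. *)
Lemma tact_eigen_eq0 n i (t : tensor n) (c : K) :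
  tact i i t = c *: t -> (forall m : nat, c != m%:R) -> t = 0.
Proof.
move=> e cN; apply/ffunP => w; rewrite ffunE.
have := tact_diag i t w; rewrite e ffunE.
move=> /eqP; rewrite -subr_eq0 -mulrBl mulf_eq0 subr_eq0 (negPf (cN _)).
by move/eqP.
Qed.

Lemma tact_eigen_shift n i j k (t : tensor n) (c : K) : tact k k t = c *: t ->
  tact k k (tact i j t) = (c + (k == i)%:R - (k == j)%:R) *: tact i j t.
Proof.
move=> e; rewrite tact_comm e linearZ /= !scalerDl scaleNr -addrA.
congr (_ + (_ - _)).
  by case: eqP => [->|_]; rewrite ?scale1r ?scale0r.
by case: eqP => [->|_]; rewrite ?scale1r ?scale0r.
Qed.

(** The sl_2 argument: with F = E_ji, one has
    E_ij F^(m+1) t = (m+1) (p - q - m) F^m t, and the coefficient never vanishes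
    when p < q.  Since F^(p+1) t = 0, because it would contain the letter i
    a negative number of times, t = 0 follows by descent. *)
Lemma highest_weight_eq0 n i j (t : tensor n) (p q : nat) : i != j ->
  tact i j t = 0 -> tact i i t = p%:R *: t -> tact j j t = q%:R *: t ->
  (p < q)%N -> t = 0.
Proof.
move=> ij et ei ej pq.
have ji : (j == i) = false by rewrite eq_sym (negPf ij).
pose F m := iter m (tact j i) t.
have Fi m : tact i i (F m) = (p%:R - m%:R) *: F m.
  elim: m => [|m IH]; first by rewrite subr0.
  rewrite [F m.+1]/(tact j i (F m)) (tact_eigen_shift j i IH) eqxx (negPf ij).
  by congr (_ *: _); rewrite -[m.+1]addn1 natrD /= mulr0n; ring.
have Fj m : tact j j (F m) = (q%:R + m%:R) *: F m.
  elim: m => [|m IH]; first by rewrite addr0.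
  rewrite [F m.+1]/(tact j i (F m)) (tact_eigen_shift j i IH) eqxx ji.
  by congr (_ *: _); rewrite -[m.+1]addn1 natrD /= mulr0n; ring.
have EF m : tact i j (F m.+1) = (m.+1%:R * (p%:R - q%:R - m%:R)) *: F m.
  elim: m => [|m IH].
    rewrite [F 1]/(tact j i t) tact_comm et linear0 !eqxx ei ej -scalerBl.
    by rewrite add0r mul1r subr0.
  rewrite [F m.+2]/(tact j i (F m.+1)) tact_comm IH linearZ !eqxx Fi Fj.
  rewrite -scalerBl /=.
  rewrite -[tact j i (F m)]/(F m.+1) -scalerDl; congr (_ *: _).
  by rewrite -[m.+2]addn1 -[m.+1]addn1 !natrD; ring.
have F0 : F p.+1 = 0.
  apply: (tact_eigen_eq0 (Fi _)) => m.
  rewrite -[p.+1]addn1 natrD opprD addrA subrr add0r.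
  by rewrite eq_sym -subr_eq0 opprK natr1 pnatr_eq0.
elim: (p.+1) F0 => [//|m IH] Fm; apply: IH.
have := EF m; rewrite Fm linear0 => /esym/eqP.
rewrite scaler_eq0 mulf_eq0 pnatr_eq0 /=.
case/orP => [|/eqP//]; rewrite -addrA -opprD subr_eq0 -natrD eqr_nat; lia.
Qed.

(** The component of [t] on the words that start with [x]; it identifies
    T_(n+1) with the direct sum of copies of T_n indexed by the letters. *)
Definition slice n x (t : tensor n.+1) : tensor n :=
  of_series n (residual x (to_series t)).
Fact slice_linear n x : linear (@slice n x).
Proof. by move=> c s t; rewrite /slice !linearP. Qed.
HB.instance Definition _ n x :=
  GRing.isLinear.Build K (tensor n.+1) (tensor n) *:%R
    (@slice n x) (@slice_linear n x).

Lemma to_series_slice n x (t : tensor n.+1) :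
  to_series (slice x t) = residual x (to_series t).
Proof. by rewrite of_seriesK //; apply/homog_residual/homog_to_series. Qed.

Lemma slice_tact n i j x (t : tensor n.+1) :
  slice x (tact i j t) = (if x == i then slice j t else 0) + tact i j (slice x t).
Proof.
apply: (can_inj (@to_seriesK n)).
rewrite to_series_slice to_series_tact residual_act.
rewrite linearD /= to_series_tact to_series_slice; congr (_ + _).
by case: eqP => _; rewrite ?linear0 ?to_series_slice.
Qed.

Lemma slice_eq0 n (t : tensor n.+1) : (forall x, slice x t = 0) -> t = 0.
Proof.
move=> t0; apply/ffunP => w; rewrite ffunE (tuple_eta w) -to_seriesE /=.
have := congr1 (fun s => to_series s (behead w)) (t0 (thead w)).
by rewrite to_series_slice linear0.
Qed.

End Tensors.

(** * Weights and highest weight vectors for three letters *)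

(** Rank-nullity in the form in which every dimension bound below uses it:
    [B] collects the kernel and [C] the image. *)
Lemma dim_ker_img (K : fieldType) (aT rT : vectType K) (f : {linear aT -> rT})
    (A B : {vspace aT}) (C : {vspace rT}) :
  (forall v, v \in A -> f v = 0 -> v \in B) -> (forall v, v \in A -> f v \in C) ->
  (\dim A <= \dim B + \dim C)%N.
Proof.
move=> AB AC; rewrite -(limg_ker_dim (linfun f) A) leq_add // dimvS //;
  apply/subvP => v.
  by rewrite memv_cap memv_ker lfunE => /andP[vA /eqP]; apply: AB.
by case/memv_imgP => w wA ->; rewrite lfunE; apply: AC.
Qed.

Definition la : 'I_3 := @Ordinal 3 0 isT.
Definition lb : 'I_3 := @Ordinal 3 1 isT.
Definition lc : 'I_3 := @Ordinal 3 2 isT.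

Lemma letterP (P : 'I_3 -> Prop) : P la -> P lb -> P lc -> forall x, P x.
Proof.
move=> Pa Pb Pc [[|[|[|m]]] lt] //.
- by rewrite (_ : Ordinal lt = la) //; apply: val_inj.
- by rewrite (_ : Ordinal lt = lb) //; apply: val_inj.
- by rewrite (_ : Ordinal lt = lc) //; apply: val_inj.
Qed.

Lemma letter_eqE : ((la == lb = false) * (la == lc = false) * (lb == la = false) *
  (lb == lc = false) * (lc == la = false) * (lc == lb = false))%type.
Proof. by []. Qed.

Section Weights.
Variables (K : numFieldType).
Local Notation T := (tensor K 'I_3).

(** The weight takes its values in the field, so that the operators which lower
    a coordinate below 0 need no separate treatment. *)
Definition has_weight n (x y z : K) (t : T n) :=
  [/\ tact la la t = x *: t, tact lb lb t = y *: t & tact lc lc t = z *: t].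

Definition eigop n i (c : K) (t : T n) : T n := tact i i t - c *: t.
Fact eigop_linear n i c : linear (@eigop n i c).
Proof.
move=> d s t; rewrite /eigop linearP /= !scalerDr scalerN !scalerA [c * d]mulrC.
by rewrite opprD addrACA.
Qed.
HB.instance Definition _ n i c :=
  GRing.isLinear.Build K (T n) (T n) *:%R (@eigop n i c) (@eigop_linear n i c).

Definition wspace n p q r : {vspace T n} :=
  (lker (linfun (@eigop n la p%:R)) :&: lker (linfun (@eigop n lb q%:R))
     :&: lker (linfun (@eigop n lc r%:R)))%VS.

Lemma mem_lker_linfun n (f : {linear T n -> T n}) t :
  (t \in lker (linfun f)) = (f t == 0).
Proof. by rewrite memv_ker lfunE. Qed.

Lemma mem_lker_eigop n i (c : K) (t : T n) :
  t \in lker (linfun (@eigop n i c)) <-> tact i i t = c *: t.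
Proof. by rewrite mem_lker_linfun /= /eigop subr_eq0; split=> /eqP. Qed.

Lemma mem_wspace n p q r (t : T n) :
  t \in wspace n p q r <-> has_weight p%:R q%:R r%:R t.
Proof.
rewrite /wspace 2!memv_cap; split=> [|[ha hb hc]].
  by case/andP => /andP[/mem_lker_eigop ? /mem_lker_eigop ?] /mem_lker_eigop ?.
by apply/andP; split; [apply/andP; split|]; apply/mem_lker_eigop.
Qed.

Lemma has_weight_tact n i j x y z (t : T n) : has_weight x y z t ->
  has_weight (x + (la == i)%:R - (la == j)%:R) (y + (lb == i)%:R - (lb == j)%:R)
    (z + (lc == i)%:R - (lc == j)%:R) (tact i j t).
Proof. by case=> ha hb hc; split; apply: tact_eigen_shift. Qed.

Lemma has_weight_ab n x y z (t : T n) :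
  has_weight x y z t -> has_weight (x + 1) (y - 1) z (tact la lb t).
Proof.
by move/(has_weight_tact la lb); rewrite !letter_eqE !eqxx ?subr0 ?addr0.
Qed.

Lemma has_weight_bc n x y z (t : T n) :
  has_weight x y z t -> has_weight x (y + 1) (z - 1) (tact lb lc t).
Proof.
by move/(has_weight_tact lb lc); rewrite !letter_eqE !eqxx ?subr0 ?addr0.
Qed.

Lemma has_weight_ac n x y z (t : T n) :
  has_weight x y z t -> has_weight (x + 1) y (z - 1) (tact la lc t).
Proof.
by move/(has_weight_tact la lc); rewrite !letter_eqE !eqxx ?subr0 ?addr0.
Qed.

Lemma has_weight_ba n x y z (t : T n) :
  has_weight x y z t -> has_weight (x - 1) (y + 1) z (tact lb la t).
Proof.
by move/(has_weight_tact lb la); rewrite !letter_eqE !eqxx ?subr0 ?addr0.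
Qed.

Lemma has_weight_slice n x y z s (t : T n.+1) :
  has_weight x y z t ->
  has_weight (x - (s == la)%:R) (y - (s == lb)%:R) (z - (s == lc)%:R) (slice s t).
Proof.
have aux i (c : K) : tact i i t = c *: t ->
    tact i i (slice s t) = (c - (s == i)%:R) *: slice s t.
  move=> e; have := slice_tact i i s t; rewrite e linearZ scalerBl /= => ->.
  case: eqP => [->|_]; rewrite ?scale1r ?scale0r ?add0r ?subr0 //.
  by rewrite addrAC subrr add0r.
by case=> ha hb hc; split; apply: aux.
Qed.

Lemma N1_neq_nat m : (0 - 1 : K) != m%:R.
Proof. by rewrite sub0r eq_sym -subr_eq0 opprK natr1 pnatr_eq0. Qed.

Lemma tact_ab_ac n (t : T n) :
  tact la lb (tact la lc t) = tact la lc (tact la lb t).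
Proof. by rewrite tact_comm !letter_eqE subrr addr0. Qed.

Lemma tact_ab_bc n (t : T n) :
  tact la lb (tact lb lc t) = tact lb lc (tact la lb t) + tact la lc t.
Proof. by rewrite tact_comm !letter_eqE eqxx subr0. Qed.

Lemma tact_ac_bc n (t : T n) :
  tact la lc (tact lb lc t) = tact lb lc (tact la lc t).
Proof. by rewrite tact_comm !letter_eqE subrr addr0. Qed.

Lemma tact_ac_ba n (t : T n) :
  tact la lc (tact lb la t) = tact lb la (tact la lc t) - tact lb lc t.
Proof. by rewrite tact_comm !letter_eqE eqxx sub0r. Qed.

Lemma tact_ab_ba n (t : T n) x y z : has_weight x y z t ->
  tact la lb (tact lb la t) = tact lb la (tact la lb t) + (x - y) *: t.
Proof. by case=> ha hb _; rewrite tact_comm !eqxx ha hb scalerBl. Qed.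

(** E_bc does not preserve the kernel of E_ab.  On vectors of weight (p,q,r) in
    that kernel the correction by E_ba E_ac does, for k = p - q + 1: this is a
    raising operator of the Mickelsson step algebra of the pair gl_3, gl_2. *)
Definition raise_bc n (k : K) (t : T n) : T n :=
  k *: tact lb lc t - tact lb la (tact la lc t).
Fact raise_bc_linear n k : linear (@raise_bc n k).
Proof.
by move=> d s t; rewrite /raise_bc !linearP /= !scalerA [k * d]mulrC addrACA.
Qed.
HB.instance Definition _ n k :=
  GRing.isLinear.Build K (T n) (T n) *:%R (@raise_bc n k) (@raise_bc_linear n k).

Lemma raise_bcE n k (t : T n) :
  raise_bc k t = k *: tact lb lc t - tact lb la (tact la lc t).
Proof. by []. Qed.

Lemma has_weight_raise_bc n k x y z (t : T n) :
  has_weight x y z t -> has_weight x (y + 1) (z - 1) (raise_bc k t).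
Proof.
move=> ht; rewrite raise_bcE.
have [a1 b1 c1] := has_weight_bc ht.
have [a2 b2 c2] := has_weight_ba (has_weight_ac ht).
split; rewrite linearB linearZ /= scalerBr.
- by rewrite a1 a2 addrK !scalerA mulrC.
- by rewrite b1 b2 !scalerA mulrC.
- by rewrite c1 c2 !scalerA mulrC.
Qed.

(** Both terms contribute a multiple of E_ac t: the coefficient is k = x - y + 1
    from E_ab E_bc, and from E_ab E_ba it is the weight x + 1 - y of E_ac t. *)
Lemma tact_ab_raise_bc n x y z (t : T n) : has_weight x y z t -> tact la lb t = 0 ->
  tact la lb (raise_bc (x - y + 1) t) = 0.
Proof.
move=> ht t0; rewrite raise_bcE linearB linearZ /= tact_ab_bc t0 linear0 add0r.
rewrite (tact_ab_ba (has_weight_ac ht)) tact_ab_ac t0 !linear0 add0r -scalerBl.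
by rewrite (_ : _ - _ = 0) ?scale0r //; ring.
Qed.

(** E_ac raises p - q by one, so this says that the two raising operators
    commute. *)
Lemma tact_ac_raise_bc n k (t : T n) :
  tact la lc (raise_bc k t) = raise_bc (k + 1) (tact la lc t).
Proof.
rewrite !raise_bcE linearB linearZ /= tact_ac_bc tact_ac_ba scalerDl scale1r opprB.
by rewrite addrA addrAC.
Qed.

(** Highest weight vectors for gl_2, acting on the first two letters. *)
Definition uspace n (V : {vspace T n}) p q r :=
  (V :&: wspace n p q r :&: lker (linfun (@tact K 'I_3 n la lb)))%VS.
(** Those gl_2-highest weight vectors that cannot be raised further from c to
    b; E_ac maps these spaces to each other. *)
Definition yspace n (V : {vspace T n}) p q r :=
  (uspace V p q r :&: lker (linfun (@raise_bc n (p%:R - q%:R + 1))))%VS.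
(** Highest weight vectors for gl_3; E_ac kills them too, as the commutator of
    E_ab and E_bc. *)
Definition hwspace n (V : {vspace T n}) p q r :=
  (uspace V p q r :&: lker (linfun (@tact K 'I_3 n lb lc)))%VS.

Lemma mem_uspace n (V : {vspace T n}) p q r t : t \in uspace V p q r <->
  [/\ t \in V, has_weight p%:R q%:R r%:R t & tact la lb t = 0].
Proof.
rewrite !(memv_cap _ _ (lker _)) memv_cap mem_lker_linfun /=.
split=> [/andP[/andP[-> /mem_wspace ?] /eqP ?] //|[-> /mem_wspace -> ->]].
by rewrite eqxx.
Qed.

Lemma mem_yspace n (V : {vspace T n}) p q r t : t \in yspace V p q r <->
  t \in uspace V p q r /\ raise_bc (p%:R - q%:R + 1) t = 0.
Proof.
rewrite memv_cap mem_lker_linfun /=.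
by split=> [/andP[-> /eqP ?] //|[-> ->]]; rewrite eqxx.
Qed.

Lemma mem_hwspace n (V : {vspace T n}) p q r t : t \in hwspace V p q r <->
  t \in uspace V p q r /\ tact lb lc t = 0.
Proof.
rewrite memv_cap mem_lker_linfun /=.
by split=> [/andP[-> /eqP ?] //|[-> ->]]; rewrite eqxx.
Qed.

Definition stable n (V : {vspace T n}) := forall i j t, t \in V -> tact i j t \in V.

Section StableSpace.
Variables (n : nat) (V : {vspace T n}).
Hypothesis stV : stable V.

Lemma dim_wspace_le p q r :
  (\dim (V :&: wspace n p q.+1 r) <=
     \dim (uspace V p q.+1 r) + \dim (V :&: wspace n p.+1 q r))%N.
Proof.
apply: (dim_ker_img (f := @tact K 'I_3 n la lb)) => t.
  by rewrite memv_cap => /andP[tV /mem_wspace ht] t0; apply/mem_uspace.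
rewrite memv_cap => /andP[tV /mem_wspace/has_weight_ab].
rewrite natr1 -[q.+1%:R]natr1 addrK => /mem_wspace ht.
by rewrite memv_cap ht andbT; apply: stV.
Qed.

Lemma uspace_nondominant p q r : (p < q)%N -> \dim (uspace V p q r) = 0%N.
Proof.
move=> pq; apply/eqP; rewrite dimv_eq0 -subv0; apply/subvP => t.
case/mem_uspace => _ [ha hb _] t0; rewrite memv0; apply/eqP.
exact: (highest_weight_eq0 _ t0 ha hb pq).
Qed.

Lemma raise_bc_uspace p q r t : t \in uspace V p q r.+1 ->
  raise_bc (p%:R - q%:R + 1) t \in uspace V p q.+1 r.
Proof.
case/mem_uspace => tV ht t0; apply/mem_uspace; split.
- by rewrite raise_bcE rpredB ?rpredZ //; do !apply: stV.
- have := has_weight_raise_bc (p%:R - q%:R + 1) ht.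
  by rewrite natr1 -[r.+1%:R]natr1 addrK.
- exact: tact_ab_raise_bc ht t0.
Qed.

Lemma dim_uspace_le p q r :
  (\dim (uspace V p q r.+1) <=
     \dim (yspace V p q r.+1) + \dim (uspace V p q.+1 r))%N.
Proof.
apply: (dim_ker_img (f := @raise_bc n (p%:R - q%:R + 1))) => t.
  by move=> tU t0; apply/mem_yspace.
exact: raise_bc_uspace.
Qed.

(** The condition q <= p makes the coefficient p - q + 1 of E_bc in [raise_bc]
    nonzero. *)
Lemma yspace_ker p q r t : (q <= p)%N -> t \in yspace V p q r ->
  tact la lc t = 0 -> t \in hwspace V p q r.
Proof.
move=> qp /mem_yspace[tU]; rewrite raise_bcE => /[swap] t0.
rewrite t0 linear0 subr0 => /eqP; rewrite scaler_eq0 => /orP[|/eqP bt].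
  by rewrite -natrB // natr1 pnatr_eq0.
by apply/mem_hwspace.
Qed.

Lemma dim_yspace_le p q r : (q <= p)%N ->
  (\dim (yspace V p q r.+1) <=
     \dim (hwspace V p q r.+1) + \dim (yspace V p.+1 q r))%N.
Proof.
move=> qp; apply: (dim_ker_img (f := @tact K 'I_3 n la lc)) => t.
  exact: yspace_ker.
case/mem_yspace => /mem_uspace[tV ht t0] rt.
apply/mem_yspace; split; first apply/mem_uspace; first split.
- exact: stV.
- by have := has_weight_ac ht; rewrite natr1 -[r.+1%:R]natr1 addrK.
- by rewrite tact_ab_ac t0 linear0.
have := tact_ac_raise_bc (p%:R - q%:R + 1) t; rewrite rt linear0 => ->.
by congr (raise_bc _ _); rewrite -natr1; ring.
Qed.

Lemma dim_yspace0_le p q : (q <= p)%N ->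
  (\dim (yspace V p q 0) <= \dim (hwspace V p q 0))%N.
Proof.
move=> qp; apply: dimvS; apply/subvP => t tY; apply: yspace_ker => //.
move: tY => /mem_yspace[/mem_uspace[_ ht _] _].
(* E_ac t has weight -1 in c, which no word has. *)
have [_ _ hc] := has_weight_ac ht; exact: tact_eigen_eq0 hc N1_neq_nat.
Qed.

End StableSpace.

(** The number of standard tableaux of shape (p,q,r), or ballot sequences with
    p, q, r votes, for n = p + q + r; the value at n = 0 matters only for
    p = q = r = 0. *)
Fixpoint ballot n p q r : nat :=
  if (r <= q <= p)%N then
    if n is n'.+1 then
      ((if r is r'.+1 then ballot n' p q r' else 0) +
       (if q is q'.+1 then ballot n' p q' r else 0) +
       (if p is p'.+1 then ballot n' p' q r else 0))%N
    else 1%N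
  else 0%N.

Lemma hwspace_nondominant n p q r : ~~ (r <= q <= p)%N ->
  \dim (hwspace {:T n} p q r) = 0%N.
Proof.
move=> N; apply/eqP; rewrite dimv_eq0 -subv0; apply/subvP => t.
case/mem_hwspace => /mem_uspace[_ [ha hb hc] tab] tbc; rewrite memv0; apply/eqP.
move: N; rewrite negb_and -!ltnNge => /orP[qr|pq].
  exact: (highest_weight_eq0 _ tbc hb hc qr).
exact: (highest_weight_eq0 _ tab ha hb pq).
Qed.

Lemma dim_tensor0 : \dim {:T 0} = 1%N.
Proof. by rewrite dimvf /dim /= card_tuple expn0. Qed.

(** Let t be a highest weight vector with components t_a, t_b, t_c after its
    first letter.  Then E_ab t = 0 and E_bc t = 0 say that t_b = - E_ab t_a,
    t_c = - E_bc t_b, and that t_c is a highest weight vector; if t_c = 0 then so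
    is t_b, and if moreover t_b = 0 then so is t_a.  This filtration realises
    the recursion of [ballot], and nondominant weights contribute nothing. *)
Lemma dim_hwspace_le n p q r : (\dim (hwspace {:T n} p q r) <= ballot n p q r)%N.
Proof.
elim: n p q r => [|n IH] p q r.
  rewrite /=; case: ifPn => [_|/hwspace_nondominant -> //].
  by apply: leq_trans (dimvS (subvf _)) _; rewrite dim_tensor0.
rewrite /=; case: ifPn => [_|/hwspace_nondominant -> //].
pose H := hwspace {:T n.+1} p q r.
pose ker s := lker (linfun (@slice K 'I_3 n s)).
have kerE s t : (t \in ker s) = (slice s t == 0) by rewrite memv_ker lfunE.
pose Hc := (H :&: ker lc)%VS; pose Hb := (Hc :&: ker lb)%VS.
have wtH t : t \in H -> has_weight p%:R q%:R r%:R t.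
  by case/mem_hwspace => /mem_uspace[].
have abH t : t \in H -> [/\ slice lb t + tact la lb (slice la t) = 0,
    tact la lb (slice lb t) = 0 & tact la lb (slice lc t) = 0].
  case/mem_hwspace => /mem_uspace[_ _ t0] _.
  have := (slice_tact la lb la t, slice_tact la lb lb t, slice_tact la lb lc t).
  by rewrite t0 !linear0 !letter_eqE !eqxx !add0r; case=> -[].
have bcH t : t \in H -> [/\ tact lb lc (slice la t) = 0,
    slice lc t + tact lb lc (slice lb t) = 0 & tact lb lc (slice lc t) = 0].
  case/mem_hwspace => _ t0.
  have := (slice_tact lb lc la t, slice_tact lb lc lb t, slice_tact lb lc lc t).
  by rewrite t0 !linear0 !letter_eqE !eqxx !add0r; case=> -[].
have in_hw s i j k t : has_weight i%:R j%:R k%:R (slice s t) ->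
    tact la lb (slice s t) = 0 -> tact lb lc (slice s t) = 0 ->
    slice s t \in hwspace {:T n} i j k.
  move=> ht tab tbc; apply/mem_hwspace; split=> //.
  by apply/mem_uspace; rewrite memvf.
have stepc : (\dim H <=
    \dim Hc + if r is r'.+1 then \dim (hwspace {:T n} p q r') else 0)%N.
  case: (r) wtH => [|r'] wtH; [rewrite -[X in (_ + X)%N](dimv0 (T n))|];
    (apply: (dim_ker_img (f := @slice K 'I_3 n lc)) => t tH;
      [by move=> t0; rewrite memv_cap tH kerE t0 eqxx|];
      have := has_weight_slice lc (wtH t tH); rewrite !letter_eqE eqxx !subr0).
    by case=> _ _ hc; rewrite memv0 /= (tact_eigen_eq0 hc N1_neq_nat).
  rewrite -natr1 addrK => ht.
  have [_ _ tab] := abH t tH; have [_ _ tbc] := bcH t tH.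
  exact: in_hw.
have HcP t : t \in Hc -> t \in H /\ slice lc t = 0.
  by rewrite memv_cap kerE => /andP[-> /eqP].
have stepb : (\dim Hc <=
    \dim Hb + if q is q'.+1 then \dim (hwspace {:T n} p q' r) else 0)%N.
  case: (q) wtH => [|q'] wtH; [rewrite -[X in (_ + X)%N](dimv0 (T n))|];
    (apply: (dim_ker_img (f := @slice K 'I_3 n lb)) => t tHc;
      [by move=> t0; rewrite memv_cap tHc kerE t0 eqxx|]; have [tH tc] := HcP t tHc;
      have := has_weight_slice lb (wtH t tH); rewrite !letter_eqE eqxx !subr0).
    by case=> _ hb _; rewrite memv0 /= (tact_eigen_eq0 hb N1_neq_nat).
  rewrite -natr1 addrK => ht; have [_ tab _] := abH t tH; have [_ + _] := bcH t tH.
  by rewrite tc add0r => tbc; apply: in_hw.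
have stepa : (\dim Hb <=
    0 + if p is p'.+1 then \dim (hwspace {:T n} p' q r) else 0)%N.
  have HbP t : t \in Hb -> [/\ t \in H, slice lc t = 0 & slice lb t = 0].
    by rewrite memv_cap kerE => /andP[/HcP[? ?] /eqP].
  rewrite -[X in (X + _)%N](dimv0 (T n.+1)).
  case: (p) wtH => [|p']  wtH; [rewrite -[X in (_ + X)%N](dimv0 (T n))|];
    (apply: (dim_ker_img (f := @slice K 'I_3 n la)) => t /HbP[tH tc tb];
      [by move=> t0; rewrite memv0; apply/eqP/slice_eq0; apply: letterP|];
      have := has_weight_slice la (wtH t tH); rewrite !letter_eqE eqxx !subr0).
    by case=> ha _ _; rewrite memv0 /= (tact_eigen_eq0 ha N1_neq_nat).
  rewrite -natr1 addrK => ht; have [+ _ _] := abH t tH; have [tbc _ _] := bcH t tH.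
  by rewrite tb add0r => tab; apply: in_hw.
apply: leq_trans stepc _; rewrite addnC -addnA; apply: leq_add; first by case: (r).
apply: leq_trans stepb _; rewrite addnC; apply: leq_add; first by case: (q).
by apply: leq_trans stepa _; rewrite add0n; case: (p).
Qed.

End Weights.

(** * The Dynkin operator *)

Section Dynkin.
Variables (K : numFieldType) (X : finType).
Implicit Types (u : series K X) (v w : seq X) (x y : X) (n : nat).

(** The operator D of degree [n.+1]. *)
Definition dynkin n (t : tensor K X n.+1) : tensor K X n.+1 :=
  of_series n.+1 (expand (nest n (to_series t))).
Fact dynkin_linear n : linear (@dynkin n).
Proof. by move=> c s t; rewrite /dynkin !linearP. Qed.
HB.instance Definition _ n :=
  GRing.isLinear.Build K (tensor K X n.+1) (tensor K X n.+1) *:%R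
    (@dynkin n) (@dynkin_linear n).

Lemma to_series_dynkin n (t : tensor K X n.+1) :
  to_series (dynkin t) = expand (nest n (to_series t)).
Proof. by rewrite of_seriesK //; apply/homog_graded/graded_nest. Qed.

Lemma dynkin_dynkin n (t : tensor K X n.+1) :
  dynkin (dynkin t) = n.+1%:R *: dynkin t.
Proof.
rewrite {1}/dynkin to_series_dynkin (nest_graded_expand (n := n.+1)).
  by rewrite !linearZ.
exact: graded_nest.
Qed.

Definition lie_tensors n : {vspace tensor K X n.+1} := limg (linfun (@dynkin n)).
Definition dynkin_kernel n : {vspace tensor K X n.+1} := lker (linfun (@dynkin n)).

Lemma mem_lie_tensors n (t : tensor K X n.+1) :
  t \in lie_tensors n <-> dynkin t = n.+1%:R *: t.
Proof.
split=> [/memv_imgP[s _ ->]|e]; first by rewrite lfunE /= dynkin_dynkin.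
have -> : t = linfun (@dynkin n) (n.+1%:R^-1 *: t).
  by rewrite linearZ /= lfunE /= e scalerA mulVf ?scale1r // pnatr_eq0.
by apply: memv_img; apply: memvf.
Qed.

Lemma mem_dynkin_kernel n (t : tensor K X n.+1) :
  t \in dynkin_kernel n <-> dynkin t = 0.
Proof. by rewrite memv_ker lfunE /=; split=> /eqP. Qed.

Definition delta_word n (w : n.-tuple X) : tensor K X n := [ffun v => (v == w)%:R].

Lemma tensor_delta n (t : tensor K X n) : t = \sum_w t w *: delta_word w.
Proof.
apply/ffunP => v; rewrite sum_ffunE (bigD1 v) //= big1 => [|w wv].
  by rewrite !ffunE eqxx addr0 [RHS]mulr1.
by rewrite !ffunE eq_sym (negPf wv) [LHS]mulr0.
Qed.

(** The rank of a projection is its trace, in the basis of words. *)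
Lemma dim_projection n (p : {linear tensor K X n -> tensor K X n})
    (A : {vspace tensor K X n}) :
  (forall t, t \in A -> p t = t) -> (forall t, p t \in A) ->
  (\dim A)%:R = \sum_w p (delta_word w) w.
Proof.
move=> pA Ap; pose b := vbasis A.
have pE t : p t = \sum_k coord b k (p t) *: b`_k by exact: coord_vbasis (Ap t).
transitivity (\sum_(k < \dim A) coord b k (p b`_k)).
  rewrite (eq_bigr (fun=> 1)) ?sumr_const ?card_ord // => k _.
  rewrite pA ?vbasis_mem ?mem_nth ?size_tuple // coord_free ?eqxx //.
  exact: basis_free (vbasisP A).
under eq_bigr => k _ do rewrite (tensor_delta b`_k) !linear_sum.
rewrite exchange_big; apply: eq_bigr => w _ /=.
rewrite [in RHS]pE sum_ffunE; apply: eq_bigr => k _.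
by rewrite !linearZ !ffunE [LHS]mulrC.
Qed.

(** The coefficient of the word [v] in the expansion of the right-normed
    bracket of [w].  As [x, P] = x P - P x, the first letter of [w] is either the
    first or the last letter of [v]. *)
Fixpoint dynkin_coef (w v : seq X) : int :=
  if w is x :: w' then
    if w' is [::] then (v == [:: x])%:R else
    if v is y :: v' then
      (if y == x then dynkin_coef w' v' else 0)
        - (if last y v' == x then dynkin_coef w' (belast y v') else 0)
    else 0
  else 0.

Lemma conv_letterl x u (v : seq X) : conv (letter K x) u v =
  if v is y :: v' then if y == x then u v' else 0 else 0.
Proof.
case: v => [|y v] /=; first by rewrite mul0r.
rewrite mul0r add0r; case: eqP => [->|/eqP/negPf yx].
  rewrite conv_homog0 ?seriesE /residual /letter ?eqxx ?mul1r // => -[|z w] //= _.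
  by rewrite eqseq_cons andbF.
rewrite (_ : residual y _ = 0) ?conv0l //.
by apply/funext => w; rewrite /residual /letter eqseq_cons yx.
Qed.

Lemma conv_letterr x u (v : seq X) : conv u (letter K x) v =
  if v is y :: v' then if last y v' == x then u (belast y v') else 0 else 0.
Proof.
elim: v u => [|y v IH] u /=; first by rewrite mulr0.
rewrite IH; case: v {IH} => [|z v] /=.
  by rewrite addr0 /letter eqseq_cons andbT; case: eqP; rewrite ?mulr1 ?mulr0.
by rewrite /letter eqseq_cons andbF mulr0 add0r.
Qed.

Definition word_series (w : seq X) : series K X := fun v => (v == w)%:R.

Lemma residual_word x y w :
  residual y (word_series (x :: w)) = if y == x then word_series w else 0.
Proof.
by apply/funext => v; rewrite /residual /word_series eqseq_cons; case: eqP.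
Qed.

Lemma expand_nest_word n w v : size w = n.+1 ->
  expand (nest n (word_series w)) v = (dynkin_coef w v)%:~R.
Proof.
elim: n w v => [|n IH] [|x w] //= v [sw].
  case: w sw => // _; rewrite (bigD1 x) //= big1 => [|y yx].
    rewrite addr0 /word_series eqxx scale1r expand_gen /letter.
    by case: eqP.
  by rewrite /word_series eqseq_cons (negPf yx) scale0r.
rewrite (bigD1 x) //= big1 => [|y yx]; last first.
  by rewrite residual_word (negPf yx) linear0 lie0r.
rewrite addr0 residual_word eqxx expand_lie expand_gen series_lieE.
rewrite !seriesE conv_letterl conv_letterr.
case: w sw => [//|x' w] sw; case: v => [|y v]; first by rewrite subrr.
by rewrite intrB; congr (_ - _); case: eqP => // _; rewrite IH.
Qed.

Lemma dynkin_delta_word n (w v : n.+1.-tuple X) :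
  dynkin (delta_word w) v = (dynkin_coef w v)%:~R.
Proof.
rewrite of_seriesE -(@expand_nest_word n) ?size_tuple //.
congr (expand (nest n _) v).
apply/funext => s; rewrite /to_series /word_series.
case: insubP => [s' _ <-|]; first by rewrite ffunE.
by have [->|//] := eqVneq s w; rewrite size_tuple eqxx.
Qed.

Lemma big_tuple_cons (R : nmodType) n (P : pred (seq X)) (F : seq X -> R) :
  \sum_(w : n.+1.-tuple X | P w) F w =
    \sum_x \sum_(w : n.-tuple X | P (x :: w)) F (x :: w).
Proof.
rewrite pair_big_dep /=.
rewrite (reindex (fun xw : X * n.-tuple X => [tuple of xw.1 :: xw.2])) //=.
exists (fun w : n.+1.-tuple X => (thead w, [tuple of behead w])) =>
  [[x w] _|w _] /=.
  by congr (_, _); apply: val_inj.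
by rewrite [RHS]tuple_eta.
Qed.

End Dynkin.

Section DynkinAction.
Variables (K : numFieldType) (m : nat).

Lemma sum_delta (V : lmodType K) (i j : 'I_m) (F : 'I_m -> 'I_m -> V) :
  \sum_k \sum_l (delta_mx i j : 'M[K]_m) k l *: F k l = F i j.
Proof.
rewrite (bigD1 i) //= [X in _ + X]big1 ?addr0 => [|k ki]; last first.
  by rewrite big1 // => l _; rewrite mxE (negPf ki) scale0r.
rewrite (bigD1 j) //= big1 ?addr0 => [|l lj]; last first.
  by rewrite mxE (negPf lj) andbF scale0r.
by rewrite mxE !eqxx scale1r.
Qed.

Lemma dynkin_tact n i j (t : tensor K 'I_m n.+1) :
  dynkin (tact i j t) = tact i j (dynkin t).
Proof.
apply: (can_inj (@to_seriesK K 'I_m n.+1)).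
by rewrite !(to_series_dynkin, to_series_tact) nest_act expand_act sum_delta.
Qed.

Lemma dynkin_eigen n i (c : K) (t : tensor K 'I_m n.+1) :
  tact i i t = c *: t -> tact i i (dynkin t) = c *: dynkin t.
Proof. by move=> e; rewrite -dynkin_tact e linearZ. Qed.

End DynkinAction.

(** * Dimensions of weight spaces as sums over words *)

Definition content p q r (w : seq 'I_3) : bool :=
  [&& count_mem la w == p, count_mem lb w == q & count_mem lc w == r]%N.

(** The sum of [F] over the words with [p] letters a, [q] letters b and [r]
    letters c, for [n = p + q + r], enumerated letter by letter so that it can
    be evaluated. *)
Fixpoint content_sum n p q r (F : seq 'I_3 -> int) : int :=
  if n is n'.+1 then
    (if p is p'.+1 then content_sum n' p' q r (fun w => F (la :: w)) else 0) +
    (if q is q'.+1 then content_sum n' p q' r (fun w => F (lb :: w)) else 0) +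
    (if r is r'.+1 then content_sum n' p q r' (fun w => F (lc :: w)) else 0)
  else F [::].

(** The trace of the Dynkin operator on the weight space (p,q,r). *)
Definition dynkin_trace p q r : int :=
  content_sum (p + q + r) p q r (fun w => dynkin_coef w w).
Definition word_count p q r : int := content_sum (p + q + r) p q r (fun=> 1).

Lemma sum_letters (V : nmodType) (F : 'I_3 -> V) :
  \sum_x F x = F la + F lb + F lc.
Proof.
rewrite !big_ord_recl big_ord0 addr0 addrA; congr (F _ + F _ + F _); exact: val_inj.
Qed.

Lemma content_sumE n p q r (F : seq 'I_3 -> int) : n = (p + q + r)%N ->
  \sum_(w : n.-tuple 'I_3 | content p q r w) F w = content_sum n p q r F.
Proof.
elim: n p q r F => [|n IH] p q r F en.
  have [-> -> ->] : [/\ p = 0, q = 0 & r = 0]%N by split; lia.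
  rewrite (big_pred1 [tuple]) // => w.
  have -> : w = [tuple] by apply: val_inj; case: w => -[].
  by rewrite /= eqxx.
rewrite big_tuple_cons sum_letters /=; congr (_ + _ + _).
- case: p en => [|p] en; first by rewrite big1.
  by rewrite -IH; [apply: eq_bigl|lia].
- case: q en => [|q] en; first by rewrite big1 // => w /and3P[].
  by rewrite -IH; [apply: eq_bigl|lia].
- case: r en => [|r] en; first by rewrite big1 // => w /and3P[].
  by rewrite -IH; [apply: eq_bigl|lia].
Qed.

Section WeightDimensions.
Variable K : numFieldType.
Local Notation T := (tensor K 'I_3).

Definition restrict n (P : pred (seq 'I_3)) (t : T n) : T n :=
  [ffun w : n.-tuple 'I_3 => if P w then t w else 0].
Fact restrict_linear n P : linear (@restrict n P).
Proof.
move=> c s t; apply/ffunP => w; rewrite !ffunE; case: (P w) => //.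
by rewrite [X in X + _]mulr0 addr0.
Qed.
HB.instance Definition _ n P :=
  GRing.isLinear.Build K (T n) (T n) *:%R (@restrict n P) (@restrict_linear n P).

Lemma restrict_wspace n p q r (t : T n) :
  restrict (content p q r) t \in wspace K n p q r.
Proof.
apply/mem_wspace; split; apply/ffunP => w; rewrite tact_diag !ffunE /content;
  case: and3P => [[/eqP ha /eqP hb /eqP hc]|_]; rewrite ?ha ?hb ?hc // mulr0;
  by rewrite [RHS]mulr0.
Qed.

Lemma restrict_id n p q r (t : T n) :
  t \in wspace K n p q r -> restrict (content p q r) t = t.
Proof.
case/mem_wspace => ha hb hc; apply/ffunP => w; rewrite ffunE.
case: ifPn => // wN; apply/esym/eqP.
have aux i m : tact i i t = m%:R *: t -> (count_mem i w == m) || (t w == 0).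
  move=> e; have := tact_diag i t w; rewrite e ffunE => /eqP.
  rewrite -subr_eq0 -mulrBl mulf_eq0 subr_eq0 eqr_nat [m == _]eq_sym; by [].
by move: wN; rewrite !negb_and; move: (aux _ _ ha) (aux _ _ hb) (aux _ _ hc);
  do 4 case: (_ == _).
Qed.

Lemma restrict_delta n (P : pred (seq 'I_3)) (w : n.-tuple 'I_3) :
  restrict P (delta_word K w) = if P w then delta_word K w else 0.
Proof.
apply/ffunP => v; rewrite !ffunE; have [->|vw] := eqVneq v w.
  by case: (P w); rewrite ffunE ?eqxx.
by rewrite if_same; case: (P w); rewrite ffunE // (negPf vw).
Qed.

Lemma tensor_subE n (c : K) (s t : T n) w : (s - c *: t) w = s w - c * t w.
Proof. by rewrite !ffunE. Qed.

Lemma dynkin_wspace n p q r (t : T n.+1) :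
  t \in wspace K n.+1 p q r -> dynkin t \in wspace K n.+1 p q r.
Proof. by case/mem_wspace => *; apply/mem_wspace; split; apply: dynkin_eigen. Qed.

(** As D^2 = (n + 1) D, the operator D / (n + 1) restricted to a weight space is a
    projection onto the Lie tensors of that weight. *)
Lemma dim_lie_wspace n p q r : n.+1 = (p + q + r)%N ->
  (n.+1 * \dim (lie_tensors K 'I_3 n :&: wspace K n.+1 p q r))%:Z =
    dynkin_trace p q r.
Proof.
move=> en; apply: (@intr_inj K).
pose f (t : T n.+1) := n.+1%:R^-1 *: dynkin (restrict (content p q r) t).
have n0 : n.+1%:R != 0 :> K by rewrite pnatr_eq0.
have f_lin : linear f.
  by move=> c s t; rewrite /f !linearP /= !scalerA mulrC.
pose F : {linear T n.+1 -> T n.+1} :=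
  HB.pack f (GRing.isLinear.Build K (T n.+1) (T n.+1) *:%R f f_lin).
have := dim_projection (p := F)
  (A := lie_tensors K 'I_3 n :&: wspace K n.+1 p q r).
move=> dimE; rewrite -[LHS]/((n.+1 * _)%:R) natrM dimE /= => [|t|t].
- rewrite /dynkin_trace -en -content_sumE // rmorph_sum mulr_sumr.
  rewrite [RHS]big_mkcond /=.
  apply: eq_bigr => w _; rewrite /f restrict_delta ffunE.
  rewrite [LHS]mulrA divff // mul1r.
  by case: ifP => _; [rewrite dynkin_delta_word|rewrite linear0 ffunE].
- rewrite memv_cap => /andP[/mem_lie_tensors e /restrict_id rt].
  by rewrite /f rt e scalerA mulVf ?scale1r.
rewrite memv_cap; apply/andP; split; last first.
  by apply/rpredZ/dynkin_wspace/restrict_wspace.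
by apply/rpredZ/mem_lie_tensors; rewrite dynkin_dynkin.
Qed.

(** 1 - D / (n + 1) is the complementary projection, onto the kernel of D, so the
    two traces add up to the trace of the identity. *)
Lemma dim_kernel_wspace n p q r : n.+1 = (p + q + r)%N ->
  (\dim (lie_tensors K 'I_3 n :&: wspace K n.+1 p q r)
    + \dim (dynkin_kernel K 'I_3 n :&: wspace K n.+1 p q r))%:Z = word_count p q r.
Proof.
move=> en; apply: (@intr_inj K).
have n0 : n.+1%:R != 0 :> K by rewrite pnatr_eq0.
pose f (t : T n.+1) := restrict (content p q r) t -
  n.+1%:R^-1 *: dynkin (restrict (content p q r) t).
have f_lin : linear f.
  by move=> c s t; rewrite /f !linearP /= scalerDr addrACA.
pose F : {linear T n.+1 -> T n.+1} :=
  HB.pack f (GRing.isLinear.Build K (T n.+1) (T n.+1) *:%R f f_lin).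
have := dim_projection (p := F)
  (A := dynkin_kernel K 'I_3 n :&: wspace K n.+1 p q r).
move=> dimE; rewrite -[LHS]/((_ + _)%:R) natrD dimE /= => [|t|t].
- have /(congr1 (fun m : int => m%:~R : K)) := dim_lie_wspace en.
  rewrite -[LHS]/((_ * _)%:R) natrM => /(canRL (mulKf n0)) ->.
  rewrite /dynkin_trace -en -content_sumE // rmorph_sum.
  rewrite [in LHS]big_mkcond mulr_sumr /=.
  rewrite -big_split /word_count -en -content_sumE // rmorph_sum [RHS]big_mkcond.
  apply: eq_bigr => w _ /=; rewrite /f restrict_delta tensor_subE.
  case: ifP => _; last by rewrite linear0 !ffunE !(mulr0, subr0, addr0).
  by rewrite dynkin_delta_word ffunE eqxx addrC subrK.
- rewrite memv_cap => /andP[/mem_dynkin_kernel e /restrict_id rt].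
  by rewrite /f rt e scaler0 subr0.
rewrite memv_cap; apply/andP; split; last first.
  by apply: rpredB; [|apply/rpredZ/dynkin_wspace]; apply: restrict_wspace.
apply/mem_dynkin_kernel; rewrite /f linearB linearZ /= dynkin_dynkin scalerA.
by rewrite mulVf // scale1r subrr.
Qed.

End WeightDimensions.

(** * The number of highest weight vectors of weight (4,4,4) *)

(** The three differences of dimensions d(p,q,r) - d(p+1,q-1,r), times 12, that
    determine the answer. *)
Lemma dynkin_trace_444 : dynkin_trace 4 4 4 = dynkin_trace 5 3 4 + (12 * 570)%N%:Z.
Proof. by apply/eqP; vm_compute. Qed.
Lemma dynkin_trace_543 : dynkin_trace 5 4 3 = dynkin_trace 6 3 3 + (12 * 771)%N%:Z.
Proof. by apply/eqP; vm_compute. Qed.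
Lemma dynkin_trace_552 : dynkin_trace 5 5 2 = dynkin_trace 6 4 2 + (12 * 236)%N%:Z.
Proof. by apply/eqP; vm_compute. Qed.

(** The highest weights involved; the first five occur in u(4,4,4), the last
    three in u(5,5,2), and all but (4,4,4) in u(5,4,3). *)
Lemma ballot_12 : [/\ ballot 12 4 4 4 = 462, ballot 12 5 4 3 = 2112,
  ballot 12 6 4 2 = 2673, ballot 12 7 4 1 = 1408 & ballot 12 8 4 0 = 275]%N /\
  [/\ ballot 12 5 5 2 = 1320, ballot 12 6 5 1 = 1155 & ballot 12 7 5 0 = 297]%N.
Proof. by vm_compute. Qed.

(** In the three weight spaces of T_12 that matter, the difference
    d(p,q,r) - d(p+1,q-1,r) equals the upper bound for u(p,q,r) that the
    numbers of ballot sequences give. *)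
Lemma word_count_444 : word_count 4 4 4 =
  word_count 5 3 4 + (462 + 2112 + 2673 + 1408 + 275)%N%:Z.
Proof. by apply/eqP; vm_compute. Qed.
Lemma word_count_543 : word_count 5 4 3 =
  word_count 6 3 3 + (2112 + 2673 + 1408 + 275 + 1320 + 1155 + 297)%N%:Z.
Proof. by apply/eqP; vm_compute. Qed.
Lemma word_count_552 : word_count 5 5 2 =
  word_count 6 4 2 + (1320 + 1155 + 297)%N%:Z.
Proof. by apply/eqP; vm_compute. Qed.

Section Main.
Variable K : numFieldType.
Local Notation T := (tensor K 'I_3).
Local Notation L := (freeLie K 'I_3).

Lemma stable_lie_tensors n : stable (lie_tensors K 'I_3 n).
Proof.
move=> i j t /mem_lie_tensors e; apply/mem_lie_tensors.
by rewrite dynkin_tact e linearZ.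
Qed.

Lemma stable_dynkin_kernel n : stable (dynkin_kernel K 'I_3 n).
Proof.
move=> i j t /mem_dynkin_kernel e; apply/mem_dynkin_kernel.
by rewrite dynkin_tact e linear0.
Qed.

(** D is multiplication by n + 1 on one subspace and 0 on the other, so they
    meet in 0. *)
Lemma dim_hwspace_split n p q r :
  (\dim (hwspace (lie_tensors K 'I_3 n) p q r)
    + \dim (hwspace (dynkin_kernel K 'I_3 n) p q r) <= ballot n.+1 p q r)%N.
Proof.
apply: leq_trans (dim_hwspace_le K n.+1 p q r).
rewrite -dimv_sum_cap [X in (_ + X <= _)%N](_ : _ = 0%N) ?addn0.
  apply: dimvS; rewrite subv_add; apply/andP.
  by split; apply/subvP => t /mem_hwspace[/mem_uspace[_ ? ?] ?];
    apply/mem_hwspace; split=> //; apply/mem_uspace; rewrite memvf.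
apply/eqP; rewrite dimv_eq0 -subv0; apply/subvP => t; rewrite memv_cap memv0.
case/andP => /mem_hwspace[/mem_uspace[/mem_lie_tensors e _ _] _].
case/mem_hwspace => /mem_uspace[/mem_dynkin_kernel e' _ _] _.
by move/eqP: e; rewrite e' eq_sym scaler_eq0 pnatr_eq0.
Qed.

Section StableDims.
Variables (n : nat) (V : {vspace T n}).
Hypothesis stV : stable V.
Local Notation d p q r := (\dim (V :&: wspace K n p q r)).
Local Notation u p q r := (\dim (uspace V p q r)).
Local Notation y p q r := (\dim (yspace V p q r)).
Local Notation h p q r := (\dim (hwspace V p q r)).

Lemma dim_yspace_543 : (y 5 4 3 <= h 5 4 3 + h 6 4 2 + h 7 4 1 + h 8 4 0)%N.
Proof.
have := dim_yspace_le stV (p := 5) (q := 4) 2 isT.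
have := dim_yspace_le stV (p := 6) (q := 4) 1 isT.
have := dim_yspace_le stV (p := 7) (q := 4) 0 isT.
have := dim_yspace0_le V (p := 8) (q := 4) isT.
lia.
Qed.

(** No step raises from c to b here: it would lead to the weight (5,6,1), whose
    gl_2-highest weight vectors vanish. *)
Lemma dim_uspace_552 : (u 5 5 2 <= h 5 5 2 + h 6 5 1 + h 7 5 0)%N.
Proof.
have := dim_uspace_le stV 5 5 1; rewrite (@uspace_nondominant _ _ _ 5 6) //.
have := dim_yspace_le stV (p := 5) (q := 5) 1 isT.
have := dim_yspace_le stV (p := 6) (q := 5) 0 isT.
have := dim_yspace0_le V (p := 7) (q := 5) isT.
lia.
Qed.

Lemma dim_wspace_444 :
  (d 4 4 4 <= d 5 3 4 + (h 4 4 4 + h 5 4 3 + h 6 4 2 + h 7 4 1 + h 8 4 0))%N.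
Proof.
have := dim_wspace_le stV 4 3 4.
have := dim_uspace_le stV 4 4 3; rewrite (@uspace_nondominant _ _ _ 4 5) //.
have := dim_yspace_le stV (p := 4) (q := 4) 3 isT.
have := dim_yspace_543; lia.
Qed.

Lemma dim_wspace_543 :
  (d 5 4 3 <= d 6 3 3 + (h 5 4 3 + h 6 4 2 + h 7 4 1 + h 8 4 0
                          + h 5 5 2 + h 6 5 1 + h 7 5 0))%N.
Proof.
have := dim_wspace_le stV 5 3 3.
have := dim_uspace_le stV 5 4 2.
have := dim_yspace_543; have := dim_uspace_552; lia.
Qed.

Lemma dim_wspace_552 : (d 5 5 2 <= d 6 4 2 + (h 5 5 2 + h 6 5 1 + h 7 5 0))%N.
Proof.
have := dim_wspace_le stV 5 4 2; have := dim_uspace_552; lia.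
Qed.

End StableDims.

(** Adding the bounds for the image and the kernel of D leaves no slack, by
    [word_count_444] and its companions, so the six bounds are equalities. *)
Lemma dim_hw_lie_tensors : \dim (hwspace (lie_tensors K 'I_3 11) 4 4 4) = 35%N.
Proof.
have lieE p q r (e : 12 = (p + q + r)%N) := @dim_lie_wspace K 11 p q r e.
have kerE p q r (e : 12 = (p + q + r)%N) := @dim_kernel_wspace K 11 p q r e.
have := dynkin_trace_444; rewrite -!lieE // => c1.
have := dynkin_trace_543; rewrite -!lieE // => c2.
have := dynkin_trace_552; rewrite -!lieE // => c3.
have := word_count_444; rewrite -!kerE // => w1.
have := word_count_543; rewrite -!kerE // => w2.
have := word_count_552; rewrite -!kerE // => w3.
have sL := @stable_lie_tensors 11; have sN := @stable_dynkin_kernel 11.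
have l1 := dim_wspace_444 sL; have l2 := dim_wspace_543 sL.
have l3 := dim_wspace_552 sL.
have k1 := dim_wspace_444 sN; have k2 := dim_wspace_543 sN.
have k3 := dim_wspace_552 sN.
have b := dim_hwspace_split 11.
case: ballot_12 => -[e1 e2 e3 e4 e5] [e6 e7 e8].
move: (b 4 4 4)%N (b 5 4 3)%N (b 6 4 2)%N (b 7 4 1)%N (b 8 4 0)%N.
move: (b 5 5 2)%N (b 6 5 1)%N (b 7 5 0)%N.
rewrite e1 e2 e3 e4 e5 e6 e7 e8 {b lieE kerE sL sN e1 e2 e3 e4 e5 e6 e7 e8}.
lia.
Qed.

End Main.

(** * From tensors back to the free Lie algebra *)

Section Transfer.
Variable K : numFieldType.
Local Notation T := (tensor K 'I_3).
Local Notation L := (freeLie K 'I_3).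
Implicit Types (z : L) (D : 'M[K]_3).

Definition to_tensor n (z : L) : T n := of_series n (expand z).
Fact to_tensor_linear n : linear (@to_tensor n).
Proof. by move=> c y z; rewrite /to_tensor !linearP. Qed.
HB.instance Definition _ n :=
  GRing.isLinear.Build K L (T n) *:%R (@to_tensor n) (@to_tensor_linear n).

(** The bracketing of the expansion of z is a nonzero multiple of z. *)
Lemma to_tensor_inj n z : fl_graded n.+1 z -> to_tensor n.+1 z = 0 -> z = 0.
Proof.
move=> gz z0; have := nest_graded_expand gz.
rewrite -(of_seriesK (homog_graded gz)) -/(to_tensor n.+1 z) z0 !linear0.
by move/esym/eqP; rewrite scaler_eq0 pnatr_eq0 => /eqP.
Qed.

Lemma to_tensor_nest n (t : T n.+1) :
  to_tensor n.+1 (nest n (to_series t)) = dynkin t.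
Proof. by []. Qed.

Lemma to_tensor_lie_tensors n z :
  fl_graded n.+1 z -> to_tensor n.+1 z \in lie_tensors K 'I_3 n.
Proof.
move=> gz; apply/mem_lie_tensors.
rewrite /dynkin of_seriesK; last exact: homog_graded.
by rewrite (nest_graded_expand gz) !linearZ.
Qed.

Lemma to_tensor_act n D z : fl_graded n z ->
  to_tensor n (fl_act D z) = \sum_i \sum_j D i j *: tact i j (to_tensor n z).
Proof.
move=> gz; rewrite /to_tensor expand_act linear_sum; apply: eq_bigr => i _ /=.
rewrite linear_sum; apply: eq_bigr => j _; rewrite linearZ /=.
by rewrite /tact of_seriesK //; apply: homog_graded.
Qed.

Lemma graded_act n D z : fl_graded n z -> fl_graded n (fl_act D z).
Proof.
have gm k y : lie_monomial k y -> fl_graded k (fl_act D y).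
  elim=> {k y} [x|k l y y' my IHy my' IHy'].
    rewrite fl_act_gen; apply: graded_sum => i.
    by apply/gradedZ/graded_monomial/lie_monomial_gen.
  rewrite fl_act_lie; apply: gradedD; apply: graded_lie => //;
    exact: graded_monomial.
move=> [r [c [m [mm ->]]]]; rewrite linear_sum; apply: graded_sum => i.
by rewrite linearZ; apply/gradedZ/gm.
Qed.

Lemma count_letters w :
  (count_mem la w + count_mem lb w + count_mem lc w = size w)%N.
Proof. by elim: w => //= x w <-; elim/letterP: x => /=; lia. Qed.

(** Off-diagonal matrix units have trace 0, hence kill z.  The differences
    E_ii - E_jj also do, so each word in the support of the expansion contains
    the three letters equally often, that is, four times each. *)
Lemma invariant_hwspace z : lie_invariants K 3 12 z ->
  to_tensor 12 z \in hwspace (lie_tensors K 'I_3 11) 4 4 4.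
Proof.
move=> [gz inv]; set t := to_tensor 12 z.
have E0 i j : i != j -> tact i j t = 0.
  move=> ij; rewrite -[LHS](sum_delta i j (fun i j => tact i j t)).
  rewrite -to_tensor_act //.
  rewrite inv ?linear0 // /sl /= /mxtrace big1 // => k _; rewrite mxE.
  by case: eqP => // ->; rewrite (negPf ij).
have Eeq i j : tact i i t = tact j j t.
  have -> : tact i i t = tact j j t +
      to_tensor 12 (fl_act (delta_mx i i - delta_mx j j) z).
    apply/eqP; rewrite to_tensor_act // addrC -subr_eq; apply/eqP.
    rewrite -[tact i i t](sum_delta i i (fun i j => tact i j t)).
    rewrite -[tact j j t](sum_delta j j (fun i j => tact i j t)) -sumrB.
    apply: eq_bigr => k _; rewrite -sumrB; apply: eq_bigr => l _.
    by rewrite -scalerBl !mxE.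
  rewrite inv ?linear0 ?addr0 // /sl /= raddfB /=.
  have tr k : \tr (delta_mx k k : 'M[K]_3) = 1.
    rewrite /mxtrace (bigD1 k) //= mxE !eqxx big1 ?addr0 // => l /negPf lk.
    by rewrite mxE lk.
  by rewrite !tr subrr.
have E4 i : tact i i t = 4%:R *: t.
  apply/ffunP => w; rewrite [RHS]ffunE.
  have eqE j : (count_mem j w)%:R * t w = tact i i t w.
    by rewrite -tact_diag (Eeq i j).
  have := congr1 (fun m => m%:R * t w) (count_letters w).
  rewrite !natrD !mulrDl !eqE size_tuple => sumE.
  have n3 : 3%:R != 0 :> K by rewrite pnatr_eq0.
  apply: (mulfI n3); rewrite [4%:R *: _]/(4%:R * _) mulrA -natrM -sumE; ring.
apply/mem_hwspace; split; last exact: E0.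
apply/mem_uspace; split; last exact: E0.
  exact: to_tensor_lie_tensors.
by split; apply: E4.
Qed.

(** A highest weight vector of weight (p,p,p) has sl_2-weight 0 for both simple
    roots.  Applying a simple lowering operator gives a vector killed by the
    corresponding raising operator and of sl_2-weight - 2, so zero; the other
    off-diagonal matrix units are commutators of the simple ones.  A diagonal
    matrix acts as p times its trace. *)
Lemma hwspace_act n (V : {vspace T n}) p D t : t \in hwspace V p p p -> \tr D = 0 ->
  \sum_i \sum_j D i j *: tact i j t = 0.
Proof.
case/mem_hwspace => /mem_uspace[_ [ha hb hc] tab] tbc trD.
have tac : tact la lc t = 0.
  by have := tact_ab_bc t; rewrite tab tbc !linear0 add0r => <-.
have tba : tact lb la t = 0.
  have [wa wb _] := has_weight_ba (And3 ha hb hc).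
  case: p ha hb hc wa wb => [|p] ha hb hc wa wb.
    exact: tact_eigen_eq0 wa (N1_neq_nat K).
  apply: (highest_weight_eq0 (i := la) (j := lb) (p := p) (q := p.+2)) => //.
  - by rewrite (tact_ab_ba (And3 ha hb hc)) tab linear0 subrr scale0r addr0.
  - by rewrite wa -natr1 addrK.
  - by rewrite wb natr1.
have tcb : tact lc lb t = 0.
  have wc := tact_eigen_shift lc lb hc; have wb := tact_eigen_shift lc lb hb.
  have := wc; have := wb; rewrite !letter_eqE !eqxx !subr0 addr0 => {}wb {}wc.
  case: p ha hb hc wc wb => [|p] ha hb hc wc wb.
    exact: tact_eigen_eq0 wb (N1_neq_nat K).
  apply: (highest_weight_eq0 (i := lb) (j := lc) (p := p) (q := p.+2)) => //.
  - by rewrite tact_comm tbc linear0 !eqxx hb hc subrr addr0.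
  - by rewrite wb -natr1 addrK.
  - by rewrite wc natr1.
have tca : tact lc la t = 0.
  have := tact_comm lc lb lb la t; rewrite tba tcb !linear0 eqxx addr0 add0r.
  by move=> <-.
rewrite !sum_letters ha hb hc tab tbc tac tba tcb tca !scaler0 !addr0 !add0r.
rewrite !scalerA -!scalerDl -!mulrDl.
by move: trD; rewrite /mxtrace sum_letters => ->; rewrite mul0r scale0r.
Qed.

(** The basis consists of the Lie elements that expand to a basis of the highest
    weight vectors of weight (4,4,4). *)
Lemma dim_lie_invariants : has_dim (lie_invariants K 3 12) 35.
Proof.
pose V := hwspace (lie_tensors K 'I_3 11) 4 4 4.
have [B VB] : exists B : 35.-tuple (T 12), basis_of V B.
  by rewrite -(dim_hw_lie_tensors K); exists (vbasis V); apply: vbasisP.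
pose e (i : 'I_35) : L := nest 11 (to_series (12%:R^-1 *: B`_i)).
have n0 : 12%:R != 0 :> K by rewrite pnatr_eq0.
have tensE (c : 'I_35 -> K) :
    to_tensor 12 (\sum_i c i *: e i) = \sum_i c i *: B`_i.
  rewrite linear_sum; apply: eq_bigr => i _.
  rewrite linearZ /= to_tensor_nest linearZ /=; congr (_ *: _).
  have : B`_i \in V by rewrite (basis_mem VB) // mem_nth // size_tuple.
  case/mem_hwspace => /mem_uspace[/mem_lie_tensors -> _ _] _.
  by rewrite scalerA mulVf ?scale1r.
have ge (c : 'I_35 -> K) : fl_graded 12 (\sum_i c i *: e i).
  by apply: graded_sum => i; apply/gradedZ/graded_nest.
exists e; split=> [c c0 i|].
  have := tensE c; rewrite c0 linear0 => /esym.
  by have /freeP freeB := basis_free VB; move/freeB; apply.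
apply/seteqP; split=> z /=.
  move=> inv; have zV := invariant_hwspace inv; case: inv => gz _.
  exists (fun i => coord B i (to_tensor 12 z)).
  apply/eqP; rewrite -subr_eq0; apply/eqP.
  apply: (@to_tensor_inj 11); last first.
    by rewrite linearB /= tensE -(coord_basis VB zV) subrr.
  by rewrite -scaleN1r; apply: gradedD => //; apply: gradedZ; apply: ge.
case=> c zE; have gz : fl_graded 12 z by rewrite zE; apply: ge.
split=> // D trD; apply: (@to_tensor_inj 11); first exact: graded_act.
rewrite to_tensor_act //.
apply: (hwspace_act (V := lie_tensors K 'I_3 11) (p := 4)) => //.
rewrite zE tensE; apply: rpred_sum => i _; apply: rpredZ.
by rewrite (basis_mem VB) // mem_nth // size_tuple.
Qed.

End Transfer.

Theorem theorem29 (R : realType) : has_dim (lie_invariants R[i] 3 12) 35.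
Proof. exact: dim_lie_invariants. Qed.
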